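(* Let $r,s\in\mathbb Z_+$, $a_1,\dots,a_r,b_1,\dots,b_s\in\mathfrak h$, $m_1,\dots,m_r,n_1,\dots,n_s\in\mathbb N$. Then, as series of operators on $W$ in the formal variables $x_1,\dots,x_r,y_1,\dots,y_s$, $$\begin{aligned}&{\circ\atop\circ}a_1^{(m_1)}(x_1)\cdots a_r^{(m_r)}(x_r){\circ\atop\circ}\cdot{\circ\atop\circ}b_1^{(n_1)}(y_1)\cdots b_s^{(n_s)}(y_s){\circ\atop\circ}\\&={\circ\atop\circ}a_1^{(m_1)}(x_1)\cdots a_r^{(m_r)}(x_r)b_1^{(n_1)}(y_1)\cdots b_s^{(n_s)}(y_s){\circ\atop\circ}\\&\quad+\sum_{\rho=1}^{\min(r,s)}\sum_{\substack{1\le i_1<\cdots<i_\rho\le r\\1\le j_1<\cdots<j_\rho\le s}}(-1)^{i_1+\cdots+i_\rho+j_1+\cdots+j_\rho}(-1)^{r\rho+\rho(\rho+1)/2}\\&\qquad\cdot\det\Big((a_{i_\alpha},b_{j_\beta})\,G_{m_{i_\alpha}n_{j_\beta}}(x_{i_\alpha},y_{j_\beta})\Big)_{\alpha,\beta=1}^\rho\\&\qquad\cdot{\circ\atop\circ}a_1^{(m_1)}(x_1)\cdots\widehat{a_{i_1}^{(m_{i_1})}(x_{i_1})}\cdots\widehat{a_{i_\rho}^{(m_{i_\rho})}(x_{i_\rho})}\cdots a_r^{(m_r)}(x_r)\\&\qquad\quad\cdot b_1^{(n_1)}(y_1)\cdots\widehat{b_{j_1}^{(n_{j_1})}(y_{j_1})}\cdots\widehat{b_{j_\rho}^{(n_{j_\rho})}(y_{j_\rho})}\cdots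 b_s^{(n_s)}(y_s){\circ\atop\circ}.\end{aligned}$$
   Context: Conventions: $\mathbb N=\{0,1,2,\dots\}$, $\mathbb Z_+=\{1,2,\dots\}$; hats denote omitted factors; $T(\cdot)$ is the tensor algebra. **The space $W$.** Let $\mathfrak h=\mathbb C^{2M}$ with a nondegenerate symmetric bilinear form $(\cdot,\cdot)$. Let $\hat{\mathfrak h}_{\mathbb Z}=\mathfrak h\otimes\mathbb C[t,t^{-1}]\oplus\mathbb C\mathbf k$, $\hat{\mathfrak h}_{\mathbb Z}^{\pm}=\mathfrak h\otimes t^{\pm1}\mathbb C[t^{\pm1}]$. $N(\hat{\mathfrak h}_{\mathbb Z})$ is the quotient of $T(\hat{\mathfrak h}_{\mathbb Z})$ by the two-sided ideal generated by $(a\otimes t^m)\otimes(b\otimes t^n)+(b\otimes t^n)\otimes(a\otimes t^m)-(a,b)\delta_{m+n,0}\mathbf k$, $(a\otimes t^p)\otimes(b\otimes t^0)+(b\otimes t^0)\otimes(a\otimes t^p)$, $(a\otimes t^q)\otimes\mathbf k-\mathbf k\otimes(a\otimes t^q)$ for $a,b\in\mathfrak h$, $m>0>n$, $p\in\mathbb Z\setminus\{0\}$, $q\in\mathbb Z$. Given any $T(\mathfrak h)$-module $U$, let $\hat{\mathfrak h}_{\mathbb Z}^+$ act on $U$ by $0$, $\mathfrak h\otimes t^0$ as $\mathfrak h$, and $\mathbf k$ by $1$; put $W=N(\hat{\mathfrak h}_{\mathbb Z})\otimes_{T(\hat{\mathfrak h}_{\mathbb Z}^+)\otimes T(\mathfrak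 h\otimes t^0)\otimes T(\mathbb C\mathbf k)}U$. Let $h(m)$ be the action of $h\otimes t^m$ on $W$ and $h(x)=\sum_{n\in\mathbb Z}h(n)x^{-n-1/2}$, $h^{(m)}(x)=\frac1{m!}\frac{d^m}{dx^m}h(x)$. **Normal ordering.** For zero modes define recursively (the empty product being $1$ and the normal ordering of a single mode being itself) $${\circ\atop\circ}a_1(0)\cdots a_r(0){\circ\atop\circ}=a_1(0){\circ\atop\circ}a_2(0)\cdots a_r(0){\circ\atop\circ}+\sum_{i=2}^r\tfrac{(-1)^{i+1}}2(a_1,a_i){\circ\atop\circ}a_2(0)\cdots\widehat{a_i(0)}\cdots a_r(0){\circ\atop\circ}.$$ In general ${\circ\atop\circ}h_1(m_1)\cdots h_r(m_r){\circ\atop\circ}$ equals $(-1)^\sigma$ times the product of all negative modes ($m_i<0$), then all positive modes ($m_i>0$), then the normal ordering of all zero modes, each of the three groups keeping its original order, where $\sigma$ is the resulting permutation of the factors. It is extended to products of series $h_i^{(m_i)}(x_i)$ coefficientwise. **The series $G_{mn}$.** $g(x,y)=\frac12x^{-1/2}y^{-1/2}(x+y)(x-y)^{-1}$, $g_{mn}(x,y)=\frac1{m!n!}\frac{\partial^{m+n}}{\partial x^m\partial y^n}g(x,y)$, $G_{mn}(x,y)=\iota_{xy}g_{mn}(x,y)$, where $\iota_{xy}$ expands negative powers of $x-y$ in nonnegative powers of $y$. *)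

(* Defs.v *)
From HB Require Import structures.
From mathcomp Require Import all_boot all_order all_algebra perm generic_quotient.
From mathcomp Require Import boolp classical_sets functions fsbigop.
From mathcomp Require Import monalg.

Set Implicit Arguments.
Unset Strict Implicit.
Unset Printing Implicit Defensive.

Import Order.TTheory GRing.Theory Num.Theory.
Local Open Scope ring_scope.
Local Open Scope quotient_scope.

Section Span.
Variables (K : comNzRingType) (V : lmodType K) (S : V -> Prop).

Definition span : {pred V} := fun v =>
  `[< exists2 l : seq (K * V), (forall x, x \in l -> S x.2) &
        v = \sum_(x <- l) x.1 *: x.2 >].

Lemma spanP v : reflect (exists2 l : seq (K * V), (forall x, x \in l -> S x.2) &
  v = \sum_(x <- l) x.1 *: x.2) (v \in span).
Proof. exact: asboolP. Qed.

Lemma span_mem v : S v -> v \in span.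
Proof.
move=> Sv; apply/spanP; exists [:: (1, v)]; last by rewrite big_cons big_nil addr0 scale1r.
by move=> x; rewrite inE => /eqP ->.
Qed.

Lemma span_scale c v : v \in span -> c *: v \in span.
Proof.
move=> /spanP[l lS ->]; apply/spanP.
exists [seq (c * x.1, x.2) | x <- l].
  by move=> _ /mapP[x xl ->]; exact: (lS x).
by rewrite big_map scaler_sumr; apply: eq_bigr => x _; rewrite scalerA.
Qed.

Lemma span_add u v : u \in span -> v \in span -> u + v \in span.
Proof.
move=> /spanP[l lS ->] /spanP[l' lS' ->]; apply/spanP; exists (l ++ l').
  by move=> x; rewrite mem_cat => /orP[/lS|/lS'].
by rewrite big_cat.
Qed.

Lemma span_zmod_closed : zmod_closed span.
Proof.
split=> [|u v uS vS]; first by apply/spanP; exists [::]; rewrite ?big_nil.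
by apply: span_add => //; rewrite -scaleN1r; exact: span_scale.
Qed.

HB.instance Definition _ := GRing.isZmodClosed.Build V span span_zmod_closed.

(* V / span S *)
Definition lquot : Type := {ideal_quot span}.

HB.instance Definition _ := EqQuotient.on lquot.
HB.instance Definition _ := GRing.Zmodule.on lquot.

Lemma lquot_eqP (u v : V) :
  reflect (\pi_lquot u = \pi_lquot v) (u - v \in span).
Proof. by rewrite Quotient.idealrBE; exact: eqP. Qed.

Lemma lquotD (u v : V) : \pi_lquot (u + v) = \pi_lquot u + \pi_lquot v.
Proof. exact: Quotient.pi_add. Qed.

Definition lquot_scale (c : K) (x : lquot) : lquot := \pi_lquot (c *: repr x).

Lemma lquotZ c (u : V) : \pi_lquot (c *: u) = lquot_scale c (\pi_lquot u).
Proof.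
by apply/lquot_eqP; rewrite -scalerBr span_scale //; apply/lquot_eqP; rewrite reprK.
Qed.

Fact lquot_scaleA c d x : lquot_scale c (lquot_scale d x) = lquot_scale (c * d) x.
Proof. by elim/quotW: x => v; rewrite -(lquotZ d) -!lquotZ scalerA. Qed.
Fact lquot_scale1 : left_id 1 lquot_scale.
Proof. by elim/quotW => v; rewrite -lquotZ scale1r. Qed.
Fact lquot_scaleDr : right_distributive lquot_scale +%R.
Proof.
by move=> c; elim/quotW => u; elim/quotW => v; rewrite -lquotD -!lquotZ scalerDr lquotD.
Qed.
Fact lquot_scaleDl x : {morph lquot_scale^~ x : c d / c + d}.
Proof. by elim/quotW: x => u c d; rewrite -!lquotZ scalerDl lquotD. Qed.

HB.instance Definition _ := GRing.Zmodule_isLmodule.Build K lquot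
  lquot_scaleA lquot_scale1 lquot_scaleDr lquot_scaleDl.

End Span.

Section AlgebraQuotient.
Variables (K : comNzRingType) (A : algType K) (S : A -> Prop).

Definition ideal_gen (x : A) : Prop := exists a s b, S s /\ x = a * s * b.

(* A modulo the two-sided ideal generated by S *)
Definition aquot : Type := lquot ideal_gen.

HB.instance Definition _ := EqQuotient.on aquot.
HB.instance Definition _ := GRing.Lmodule.on aquot.

Lemma aquot_eqP (x y : A) :
  reflect (\pi_aquot x = \pi_aquot y) (x - y \in span ideal_gen).
Proof. exact: lquot_eqP. Qed.

Lemma ideal_mull a x : x \in span ideal_gen -> a * x \in span ideal_gen.
Proof.
move=> /spanP[l lS ->]; apply/spanP; exists [seq (x.1, a * x.2) | x <- l].
  move=> _ /mapP[t /lS[b [s [c [Ss ->]]]] ->].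
  by exists (a * b), s, c; rewrite !mulrA.
by rewrite big_map mulr_sumr; apply: eq_bigr => i _; rewrite -scalerAr.
Qed.

Lemma ideal_mulr a x : x \in span ideal_gen -> x * a \in span ideal_gen.
Proof.
move=> /spanP[l lS ->]; apply/spanP; exists [seq (x.1, x.2 * a) | x <- l].
  move=> _ /mapP[t /lS[b [s [c [Ss ->]]]] ->].
  by exists b, s, (c * a); rewrite !mulrA.
by rewrite big_map mulr_suml; apply: eq_bigr => i _; rewrite -scalerAl.
Qed.

Definition aquot_mul (x y : aquot) : aquot := \pi_aquot (repr x * repr y).

Lemma aquotM x y : \pi_aquot (x * y) = aquot_mul (\pi_aquot x) (\pi_aquot y).
Proof.
apply/aquot_eqP.
set x' := repr _; set y' := repr _.
have -> : x * y - x' * y' = (x - x') * y + x' * (y - y').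
  by rewrite mulrBl mulrBr addrA subrK.
apply: span_add; [apply: ideal_mulr|apply: ideal_mull];
  by apply/aquot_eqP; rewrite reprK.
Qed.

Lemma aquotD x y : \pi_aquot (x + y) = \pi_aquot x + \pi_aquot y.
Proof. exact: lquotD. Qed.

Lemma aquotZ c x : \pi_aquot (c *: x) = c *: \pi_aquot x.
Proof. exact: lquotZ. Qed.

Fact aquot_mulA : associative aquot_mul.
Proof.
elim/quotW => x; elim/quotW => y; elim/quotW => z.
by rewrite -(aquotM y z) -(aquotM x y) -(aquotM x) -(aquotM (x * y)) mulrA.
Qed.
Fact aquot_mul1l : left_id (\pi_aquot 1) aquot_mul.
Proof. by elim/quotW => x; rewrite -!aquotM mul1r. Qed.
Fact aquot_mul1r : right_id (\pi_aquot 1) aquot_mul.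
Proof. by elim/quotW => x; rewrite -!aquotM mulr1. Qed.
Fact aquot_mulDl : left_distributive aquot_mul +%R.
Proof.
elim/quotW => x; elim/quotW => y; elim/quotW => z.
by rewrite -aquotD -(aquotM (x + y)) -(aquotM x) -(aquotM y) mulrDl aquotD.
Qed.
Fact aquot_mulDr : right_distributive aquot_mul +%R.
Proof.
elim/quotW => x; elim/quotW => y; elim/quotW => z.
by rewrite -aquotD -(aquotM x (y + z)) -(aquotM x y) -(aquotM x z) mulrDr aquotD.
Qed.

HB.instance Definition _ := GRing.Zmodule_isPzRing.Build aquot
  aquot_mulA aquot_mul1l aquot_mul1r aquot_mulDl aquot_mulDr.

Lemma aquot_scaleAl c (x y : aquot) : c *: (x * y) = c *: x * y.
Proof.
elim/quotW: x => x; elim/quotW: y => y.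
by rewrite -[_ * _]aquotM -!aquotZ -[RHS]aquotM scalerAl.
Qed.

Lemma aquot_scaleAr c (x y : aquot) : c *: (x * y) = x * (c *: y).
Proof.
elim/quotW: x => x; elim/quotW: y => y.
by rewrite -[_ * _]aquotM -!aquotZ -[RHS]aquotM scalerAr.
Qed.

End AlgebraQuotient.

Section FreeAlgebra.
Variables (K : comNzRingType) (X : choiceType).

(* noncommutative polynomials in the indeterminates X *)
Definition freealg : Type := {malg K[{fmonom X}]}.

HB.instance Definition _ := GRing.Lalgebra.on freealg.

Fact freealg_scaleAr c (x y : freealg) : c *: (x * y) = x * (c *: y).
Proof.
rewrite [x * y]malgME (malgMEw (finmap.fsubset_refl (msupp x)) (msuppZ_le c y)).
rewrite scaler_sumr; apply: eq_bigr => k _; rewrite scaler_sumr.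
apply: eq_bigr => l _; rewrite mcoeffZ mulrCA.
by apply/malgP => m; rewrite mcoeffZ !mcoeffU mulrnAr.
Qed.

HB.instance Definition _ := GRing.Lalgebra_isAlgebra.Build K freealg
  freealg_scaleAr.

Definition freegen (x : X) : freealg := << fmu x >>.

End FreeAlgebra.
Arguments freegen {K X} x.

Section TensorAlgebra.
Variables (K : comNzRingType) (V : lmodType K).

Inductive tensalg_rel : freealg K V -> Prop :=
| TensalgD u v : tensalg_rel (freegen (u + v) - (freegen u + freegen v))
| TensalgZ c v : tensalg_rel (freegen (c *: v) - c *: freegen v).

Definition tensalg : Type := aquot tensalg_rel.

HB.instance Definition _ := EqQuotient.on tensalg.
HB.instance Definition _ := GRing.Lmodule.on tensalg.
HB.instance Definition _ := GRing.PzRing.on tensalg.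

Fact tensalg_neq0 : 1 != 0 :> tensalg.
Proof.
have pi0 : \pi_(aquot tensalg_rel) 0 = 0 by rewrite -(scale0r 0) aquotZ scale0r.
apply/eqP => e; have /aquot_eqP : \pi_(aquot tensalg_rel) 1 = \pi_(aquot tensalg_rel) 0.
  by rewrite pi0; exact: e.
rewrite subr0 => /spanP[l lS e1].
have {e1} := congr1 (fun x : {malg K[{fmonom V}]} => mcoeff mone x) e1.
have gen0 v : mcoeff mone (freegen v : {malg K[{fmonom V}]}) = 0.
  by rewrite mcoeffU fmP fmU fm1.
rewrite mcoeff1 eqxx raddf_sum big_seq big1 => [/eqP|[c x] /lS/= [a [r [b [Sr ->]]]]].
  by rewrite oner_eq0.
rewrite mcoeffZ !rmorphM /=.
suff -> : mcoeff mone (r : {malg K[{fmonom V}]}) = 0 by rewrite mulr0 mul0r mulr0.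
by case: Sr => *; rewrite mcoeffB ?mcoeffD ?mcoeffZ !gen0 ?mulr0 ?addr0 subrr.
Qed.

HB.instance Definition _ := GRing.PzSemiRing_isNonZero.Build tensalg tensalg_neq0.
HB.instance Definition _ := GRing.Lmodule_isLalgebra.Build K tensalg
  (@aquot_scaleAl K _ tensalg_rel).
HB.instance Definition _ := GRing.Lalgebra_isAlgebra.Build K tensalg
  (@aquot_scaleAr K _ tensalg_rel).

Definition tensgen (v : V) : tensalg := \pi_(aquot tensalg_rel) (freegen v).

End TensorAlgebra.

Section Tensor.
Variables (K : comNzRingType) (P Q : lmodType K).
Variables (I : Type) (actP : I -> P -> P) (actQ : I -> Q -> Q).

Local Notation free := {malg K[(P * Q)%type]}.
Local Notation "p *t q" := (<< ((p, q) : (P * Q)%type) >> : free)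
  (at level 40).

Inductive tens_rel : free -> Prop :=
| TensDl p p' q : tens_rel ((p + p') *t q - (p *t q + p' *t q))
| TensDr p q q' : tens_rel (p *t (q + q') - (p *t q + p *t q'))
| TensZl c p q : tens_rel ((c *: p) *t q - c *: (p *t q))
| TensZr c p q : tens_rel (p *t (c *: q) - c *: (p *t q))
| TensBal i p q : tens_rel (actP i p *t q - p *t actQ i q).

(* P (x) Q over K, balanced over the operators I acting on P (on the right)
   and on Q (on the left): this is the tensor product over any K-algebra
   generated by I. *)
Definition tens : Type := lquot tens_rel.

HB.instance Definition _ := EqQuotient.on tens.
HB.instance Definition _ := GRing.Lmodule.on tens.

Definition tensor (p : P) (q : Q) : tens := \pi_(lquot tens_rel) (p *t q).

Let tensE (g1 g2 : free) : tens_rel (g1 - g2) ->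
  \pi_(lquot tens_rel) g1 = \pi_(lquot tens_rel) g2 :> tens.
Proof. by move=> t; apply/lquot_eqP; exact: span_mem. Qed.

Lemma tensorDl p p' q : tensor (p + p') q = tensor p q + tensor p' q.
Proof. exact: etrans (tensE (TensDl p p' q)) (lquotD _ _ _). Qed.

Lemma tensorDr p q q' : tensor p (q + q') = tensor p q + tensor p q'.
Proof. exact: etrans (tensE (TensDr p q q')) (lquotD _ _ _). Qed.

Lemma tensorZl c p q : tensor (c *: p) q = c *: tensor p q.
Proof. exact: etrans (tensE (TensZl c p q)) (lquotZ _ _ _). Qed.

Lemma tensorZr c p q : tensor p (c *: q) = c *: tensor p q.
Proof. exact: etrans (tensE (TensZr c p q)) (lquotZ _ _ _). Qed.

Lemma tensor_act i p q : tensor (actP i p) q = tensor p (actQ i q).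
Proof. exact: tensE (TensBal i p q). Qed.

(* f (x) id, for f linear and commuting with every actP i *)
Definition tens_map (f : P -> P) (w : tens) : tens :=
  \sum_(x <- finmap.enum_fset (msupp (repr w))) mcoeff x (repr w) *: tensor (f x.1) x.2.

Section TensMapE.
Variable f : {linear P -> P}.
Hypothesis f_act : forall i, {morph f : p / actP i p}.

Let F (g : free) : tens :=
  \sum_(x <- finmap.enum_fset (msupp g)) mcoeff x g *: tensor (f x.1) x.2.

Let FE (d : finmap.finset_of (Phant (P * Q))) g : finmap.fsubset (msupp g) d ->
  F g = \sum_(x <- finmap.enum_fset d) mcoeff x g *: tensor (f x.1) x.2.
Proof.
move=> sub; rewrite /F; apply: finmap.big_fset_incl => // x _ /mcoeff_outdom ->.
by rewrite scale0r.
Qed.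

Let FD g g' : F (g + g') = F g + F g'.
Proof.
pose d := finmap.fsetU (msupp g) (finmap.fsetU (msupp g') (msupp (g + g'))).
have sg : finmap.fsubset (msupp g) d by rewrite finmap.fsubsetUl.
have sg' : finmap.fsubset (msupp g') d by rewrite /d finmap.fsetUCA finmap.fsubsetUl.
have sgg' : finmap.fsubset (msupp (g + g')) d by rewrite /d finmap.fsetUA finmap.fsubsetUr.
rewrite (FE sg) (FE sg') (FE sgg') -big_split.
by apply: eq_bigr => x _ /=; rewrite mcoeffD scalerDl.
Qed.

Let FZ c g : F (c *: g) = c *: F g.
Proof.
rewrite (FE (msuppZ_le c g)) scaler_sumr.
by apply: eq_bigr => x _; rewrite mcoeffZ scalerA.
Qed.

Let F1 p q : F (p *t q) = tensor (f p) q.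
Proof.
by rewrite (FE msuppU_le) finmap.big_seq_fset1 mcoeffUU scale1r.
Qed.

Let FB g g' : F (g - g') = F g - F g'.
Proof. by rewrite -scaleN1r FD FZ scaleN1r. Qed.

Let Frel g : tens_rel g -> F g = 0.
Proof.
case=> [p p' q0|p q0 q1|c p q0|c p q0|i p q0];
  rewrite FB ?FD ?FZ !F1; apply/eqP; rewrite subr_eq0; apply/eqP.
- by rewrite linearD tensorDl.
- exact: tensorDr.
- by rewrite linearZ tensorZl.
- exact: tensorZr.
- by rewrite f_act tensor_act.
Qed.

Lemma tens_mapE p q : tens_map f (tensor p q) = tensor (f p) q.
Proof.
have /lquot_eqP/spanP[l lS] :
    \pi_(lquot tens_rel) (repr (tensor p q : lquot tens_rel)) =
    \pi_(lquot tens_rel) (p *t q) by rewrite reprK.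
move=> /(congr1 F); rewrite FB F1 => e.
apply/eqP; rewrite -subr_eq0; apply/eqP; rewrite -[LHS]/(F _ - _) e.
elim: l lS {e} => [|[c g] l IH] lS.
  by rewrite big_nil -(scale0r 0) FZ !scale0r.
rewrite big_cons FD FZ Frel; last by apply: (lS (c, g)); rewrite mem_head.
by rewrite scaler0 add0r IH // => x xl; apply: lS; rewrite inE xl orbT.
Qed.

End TensMapE.

End Tensor.

Section RestrictScalars.
Variables (K : comNzRingType) (A : algType K) (U : lmodType A).

Definition restr_scalars : Type := U.

HB.instance Definition _ := GRing.Zmodule.on restr_scalars.

Definition restr_scale (c : K) (u : restr_scalars) : restr_scalars :=
  (c%:A : A) *: (u : U).

Fact restr_scaleA c d u : restr_scale c (restr_scale d u) = restr_scale (c * d) u.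
Proof. by rewrite /restr_scale scalerA -scalerAl mul1r scalerA. Qed.
Fact restr_scale1 : left_id 1 restr_scale.
Proof. by move=> u; rewrite /restr_scale !scale1r. Qed.
Fact restr_scaleDr : right_distributive restr_scale +%R.
Proof. by move=> c u v; rewrite /restr_scale scalerDr. Qed.
Fact restr_scaleDl u : {morph restr_scale^~ u : c d / c + d}.
Proof. by move=> c d; rewrite /restr_scale !scalerDl. Qed.

HB.instance Definition _ := GRing.Zmodule_isLmodule.Build K restr_scalars
  restr_scaleA restr_scale1 restr_scaleDr restr_scaleDl.

End RestrictScalars.

Section SpaceW.
Variables (K : numFieldType) (h : lmodType K) (form : h -> h -> K).

(* K[t, t^-1], the basis element << n >> being t^n *)
Definition laurent : Type := {malg K[int]}.
HB.instance Definition _ := GRing.Lmodule.on laurent.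

Definition loop : Type := tens (fun _ : void => @idfun h) (fun _ => @idfun laurent).
HB.instance Definition _ := GRing.Lmodule.on loop.

(* h (x) K[t, t^-1] (+) K k *)
Definition hhat : Type := (loop * K^o)%type.
HB.instance Definition _ := GRing.Lmodule.on hhat.

Definition hmode (a : h) (n : int) : hhat :=
  (tensor _ _ a (<< n >> : laurent) : loop, 0).
Definition hcentral : hhat := (0, 1).

Local Notation ht a n := (tensgen (hmode a n)).
Local Notation kk := (tensgen hcentral).

Inductive nalg_rel : tensalg hhat -> Prop :=
| NalgPosNeg a b (m n : int) : 0 < m -> n < 0 ->
    nalg_rel (ht a m * ht b n + ht b n * ht a m
              - (form a b * (m + n == 0)%:R) *: kk)
| NalgZero a b (p : int) : p != 0 ->
    nalg_rel (ht a p * ht b 0 + ht b 0 * ht a p)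
| NalgCentral a (q : int) : nalg_rel (ht a q * kk - kk * ht a q).

Definition nalg : Type := aquot nalg_rel.
HB.instance Definition _ := GRing.Lmodule.on nalg.
HB.instance Definition _ := GRing.PzRing.on nalg.

Definition nmode (a : h) (n : int) : nalg := \pi_(aquot nalg_rel) (ht a n).
Definition ncentral : nalg := \pi_(aquot nalg_rel) kk.

Variable U : lmodType (tensalg h).

(* Generators of T(hhat^+) (x) T(h t^0) (x) T(K k), with their actions by right
   multiplication on N(hhat) and by left multiplication on U. *)
Inductive bgen : Type :=
| BPos of h & nat   (* a t^(n+1) *)
| BZero of h        (* a t^0 *)
| BCentral.         (* k *)

Definition bgen_nalg (g : bgen) (x : nalg) : nalg :=
  match g with
  | BPos a n => x * nmode a n.+1%:Z
  | BZero a => x * nmode a 0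
  | BCentral => x * ncentral
  end.

Definition bgen_U (g : bgen) (u : restr_scalars U) : restr_scalars U :=
  match g with
  | BPos _ _ => 0
  | BZero a => tensgen a *: (u : U)
  | BCentral => u
  end.

Definition spaceW : Type := tens bgen_nalg bgen_U.
HB.instance Definition _ := GRing.Lmodule.on spaceW.

Definition mode (a : h) (n : int) : spaceW -> spaceW :=
  tens_map (fun x : nalg => nmode a n * x).

Lemma modeE a n (x : nalg) (u : restr_scalars U) :
  mode a n (tensor _ _ x u) = tensor _ _ (nmode a n * x) u.
Proof.
pose f : nalg -> nalg := fun y => nmode a n * y.
have fl : linear f.
  by move=> c y z; rewrite /f mulrDr; congr (_ + _); rewrite aquot_scaleAr.
pose lf := GRing.isLinear.Build K nalg nalg *:%R f fl.
pose F : {linear nalg -> nalg} := HB.pack f lf.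
by apply: (@tens_mapE _ _ _ _ _ _ F) => -[b k|b|] y; rewrite /= /f mulrA.
Qed.

(* [nord0_rec k s] with k >= size s; the i-th entry of s' is a_(i+2). *)
Fixpoint nord0_rec (k : nat) (s : seq h) : spaceW -> spaceW :=
  match k, s with
  | k'.+1, a :: s' =>
      (mode a 0 \o nord0_rec k' s')
      + \sum_(i < size s') ((-1) ^+ i.+3 / 2 * form a (nth 0 s' i))
                             *: nord0_rec k' (take i s' ++ drop i.+1 s')
  | _, _ => idfun
  end.

Definition nord0 (s : seq h) : spaceW -> spaceW := nord0_rec (size s) s.

Section NormalOrder.
Variable s : seq (h * int).

Definition mode_index (i : 'I_(size s)) : int := (tnth (in_tuple s) i).2.

(* the positions of the modes of s, listed in normal order *)
Definition nord_seq : seq 'I_(size s) :=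
  [seq i <- enum 'I_(size s) | mode_index i < 0] ++
  [seq i <- enum 'I_(size s) | mode_index i > 0] ++
  [seq i <- enum 'I_(size s) | mode_index i == 0].

Lemma nord_seq_perm : perm_eq nord_seq (enum 'I_(size s)).
Proof.
have ue := enum_uniq 'I_(size s).
apply: uniq_perm => //; last first.
  by move=> i; rewrite !mem_cat !mem_filter; case: ltgtP; rewrite /= ?orbF.
rewrite /nord_seq !cat_uniq !(filter_uniq _ ue) andbT /=; apply/andP; split;
  apply/hasPn => i; rewrite ?mem_cat !mem_filter => /=.
  by case: ltgtP.
by move=> /andP[/eqP-> _]; rewrite ltxx.
Qed.

Definition nord_fun (i : 'I_(size s)) : 'I_(size s) := nth i nord_seq i.

Lemma nord_fun_inj : injective nord_fun.
Proof.
have sz : size nord_seq = size s by rewrite (perm_size nord_seq_perm) size_enum_ord.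
have un : uniq nord_seq by rewrite (perm_uniq nord_seq_perm) enum_uniq.
move=> i j; rewrite /nord_fun (set_nth_default i) ?sz // => /eqP.
by rewrite nth_uniq ?sz // => /eqP/val_inj.
Qed.

Definition nord_perm : 'S_(size s) := perm nord_fun_inj.

Definition prod_modes (l : seq (h * int)) : spaceW -> spaceW :=
  foldr (fun x f => mode x.1 x.2 \o f) idfun l.

Definition nord : spaceW -> spaceW :=
  (-1) ^+ nord_perm *:
    (prod_modes [seq x <- s | x.2 < 0] \o
     prod_modes [seq x <- s | x.2 > 0] \o
     nord0 [seq x.1 | x <- s & x.2 == 0]).

End NormalOrder.
End SpaceW.
Arguments nord {K h} form U s.

(* A formal series in x with exponents in rat is given by its coefficients
   f : rat -> K, the coefficient of x^q being f q. *)

Section Series.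
Variable K : numFieldType.

Definition monom (p : rat) : rat -> K := fun q => (q == p)%:R.

(* d/dx *)
Definition sderiv (f : rat -> K) : rat -> K :=
  fun q => ratr (q + 1) * f (q + 1).

(* (1/m!) d^m/dx^m *)
Definition sderivd (m : nat) (f : rat -> K) : rat -> K :=
  fun q => (m`!%:R)^-1 * iter m sderiv f q.

(* Elements of K[x^(1/2), x^(-1/2), y^(1/2), y^(-1/2), (x - y)^(-1)]:
   a term (c, p, q, k) stands for c x^p y^q (x - y)^k, and a sequence of terms
   for their sum. *)
Definition gterm : Type := (K * rat * rat * int)%type.

Definition gterm_dx (t : gterm) : seq gterm :=
  let: (c, p, q, k) := t in
  [:: (c * ratr p, p - 1, q, k); (c * k%:~R, p, q, k - 1)].

Definition gterm_dy (t : gterm) : seq gterm :=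
  let: (c, p, q, k) := t in
  [:: (c * ratr q, p, q - 1, k); (- (c * k%:~R), p, q, k - 1)].

Definition gdx (g : seq gterm) : seq gterm := flatten (map gterm_dx g).
Definition gdy (g : seq gterm) : seq gterm := flatten (map gterm_dy g).

Definition gscale (c : K) (g : seq gterm) : seq gterm :=
  [seq (let: (d, p, q, k) := t in (c * d, p, q, k)) | t <- g].

(* 1/2 x^(-1/2) y^(-1/2) (x + y) (x - y)^(-1) *)
Definition gxy : seq gterm :=
  [:: (2^-1, 1 / 2, - (1 / 2), - 1); (2^-1, - (1 / 2), 1 / 2, - 1)].

Definition gmn (m n : nat) : seq gterm :=
  gscale (m`!%:R * n`!%:R)^-1 (iter m gdx (iter n gdy gxy)).

Definition binz (k : int) (i : nat) : K :=
  (\prod_(j < i) (k - j%:Z)%:~R) / i`!%:R.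

(* iota_xy (c x^p y^q (x - y)^k)
     = \sum_i c 'C(k, i) (-1)^i x^(p + k - i) y^(q + i);
   a series in x and y maps (P, Q) to the coefficient of x^P y^Q. *)
Definition iota_term (t : gterm) (P Q : rat) : K :=
  let: (c, p, q, k) := t in
  \sum_(i \in [set: nat])
    c * binz k i * (-1) ^+ i * monom (p + k%:~R - i%:R) P * monom (q + i%:R) Q.

Definition iota_xy (g : seq gterm) (P Q : rat) : K :=
  \sum_(t <- g) iota_term t P Q.

Definition G (m n : nat) : rat -> rat -> K := iota_xy (gmn m n).

End Series.

Section Fields.
Variables (K : numFieldType) (h : lmodType K) (form : h -> h -> K).
Variable U : lmodType (tensalg h).

(* The entry (a, m, q) of s stands for the factor a^(m)(x) with the exponent q
   chosen for its variable x. As a^(m)(x) is the sum over n of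
   a(n) (1/m!) (d/dx)^m x^(-n-1/2), the coefficient at these exponents of the
   normal ordered product of the factors is the following sum (it has at most
   one nonzero term). Series in disjoint sets of variables are multiplied by
   multiplying their coefficients; this applies to the composite of two normal
   ordered products and to each term of the Leibniz expansion of a determinant
   of series G(x_i, y_j) with distinct x_i and distinct y_j, so that taking
   coefficients commutes with such a determinant. *)
Definition nord_fields (s : seq (h * nat * rat)) :
    spaceW form U -> spaceW form U :=
  \sum_(n \in [set: (size s).-tuple int])
    (\prod_(i < size s)
       let: (a, m, q) := tnth (in_tuple s) i in
       sderivd m (monom K (- (tnth n i)%:~R - 1 / 2)) q) *:
    nord form U [seq (x.1.1.1, x.2) | x <- zip s n].

End Fields.

Definition increasing (k n : nat) (i : {ffun 'I_k -> 'I_n}) : bool :=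
  [forall x : 'I_k, forall y : 'I_k, (x < y)%N ==> (i x < i y)%N].

Arguments nord_fields {K h} form U s.
Arguments G {K} m n.

(* Main.v *)
Require Import Defs.
From HB Require Import structures.
From mathcomp Require Import all_boot all_order all_algebra sesquilinear.
From mathcomp Require Import perm generic_quotient finmap monalg zify ring lra.
From mathcomp Require Import boolp classical_sets fsbigop.
From mathcomp Require Import functions reals complex.

(* Words in letters x are acted on by the antiderivations sending x to the scalar
   phi(x); these anticommute. Writing iota_x for the antiderivation given by the
   contractions with x, the recursive definitions of normal ordering and the
   (anti)commutation relations of the modes amount to the single rule
     :x w: = x :w: - :iota_x w:,
   where two modes contract to (a, b) times 1, 1/2 or 0. From this rule alone,
   induction on w gives :w: :w': = :w * w':, where w * w' is the signed sum of all
   partial contractions of w against w'. Expanding determinants along the first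
   column turns w * w' into the sum of the theorem. Taking coefficients of the fields
   multiplies the contraction of two modes by scalars, and the result is
   (a, b) G_mn because the expansion iota_xy commutes with d/dx and d/dy. *)

Set Implicit Arguments.
Unset Strict Implicit.
Unset Printing Implicit Defensive.

Import Order.TTheory GRing.Theory Num.Theory.
Local Open Scope quotient_scope.
Local Open Scope ring_scope.

(** * Contractions of words *)

(** The defining relations of N say nothing about two positive, two negative or two zero modes, so
    letters of the same kind cannot be reordered and a normal ordered product does not alternate in
    its factors. Hence the rule is one-sided: it peels off the leftmost letter, and that letter
    contracts only with letters to its right, through a pairing that is not symmetric. Formal sums
    of words are never formed. Every operation on words is transposed to an operation on functions
    of words with values in a module (in the end, operators on W), and such a function stands for
    its own linear extension. Signs and recursions then become identities between values. The
    exponents of all variables are fixed throughout. The coefficient of x^q in a^(m)(x) is a scalar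
    times a single mode, so a product of series becomes one finite word in the letters (a, m, q),
    and the sums over mode indices disappear. *)

Section Contraction.
Variables (K : comNzRingType) (X : Type) (V : lmodType K).
Implicit Types (phi psi : X -> K) (f g : seq X -> V) (s t : seq X).

(* The transpose of the antiderivation: the value of [f], extended linearly, at the sum
   over j of (-1)^j phi(s_j) times [s] with its j-th letter omitted. *)
Fixpoint deriv_word phi f s : V :=
  if s is y :: s' then phi y *: f s' - deriv_word phi (f \o cons y) s' else 0.

Lemma deriv_word_nil phi f : deriv_word phi f [::] = 0. Proof. by []. Qed.

Lemma deriv_word_cons phi f y s :
  deriv_word phi f (y :: s) = phi y *: f s - deriv_word phi (f \o cons y) s.
Proof. by []. Qed.

Arguments deriv_word : simpl never.

Lemma eq_deriv_word phi psi f g s :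
  phi =1 psi -> f =1 g -> deriv_word phi f s = deriv_word psi g s.
Proof.
move=> e; elim: s f g => // y s IH f g fg.
by rewrite !deriv_word_cons e fg (IH _ (g \o cons y)) // => t /=; exact: fg.
Qed.

Lemma eq_deriv_wordr phi f g s : f =1 g -> deriv_word phi f s = deriv_word phi g s.
Proof. exact: eq_deriv_word. Qed.

(** Only strictly shorter words are ever passed to [f]; this lets an induction on length be used
    under the antiderivation. *)
Lemma eq_deriv_word_size phi f g s :
  (forall t, (size t < size s)%N -> f t = g t) -> deriv_word phi f s = deriv_word phi g s.
Proof.
elim: s f g => // y s IH f g fg.
rewrite !deriv_word_cons fg //; congr (_ - _); apply: IH => t ts.
exact: fg.
Qed.

Lemma deriv_wordD phi f g s :
  deriv_word phi (fun t => f t + g t) s = deriv_word phi f s + deriv_word phi g s.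
Proof.
elim: s f g => [|y s IH] f g; first by rewrite !deriv_word_nil addr0.
by rewrite !deriv_word_cons -(addrACA (phi y *: f s)) -opprD -IH -scalerDr.
Qed.

Lemma deriv_wordZ phi c f s :
  deriv_word phi (fun t => c *: f t) s = c *: deriv_word phi f s.
Proof.
elim: s f => [|y s IH] f; first by rewrite !deriv_word_nil scaler0.
by rewrite !deriv_word_cons scalerBr -IH !scalerA mulrC.
Qed.

Lemma deriv_wordN phi f s : deriv_word phi (fun t => - f t) s = - deriv_word phi f s.
Proof.
by rewrite -scaleN1r -deriv_wordZ; apply: eq_deriv_wordr => t; rewrite scaleN1r.
Qed.

Lemma deriv_wordB phi f g s :
  deriv_word phi (fun t => f t - g t) s = deriv_word phi f s - deriv_word phi g s.
Proof. by rewrite deriv_wordD deriv_wordN. Qed.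

Lemma deriv_word_exchange phi psi (F : seq X -> seq X -> V) s t :
  deriv_word phi (fun u => deriv_word psi (F u) t) s =
  deriv_word psi (fun v => deriv_word phi (F^~ v) s) t.
Proof.
elim: s F => [|y s IH] F.
  rewrite deriv_word_nil; elim: t (F) => // y t IH G.
  by rewrite deriv_word_cons scaler0 -(IH (fun u v => G u (y :: v))) subr0.
rewrite deriv_word_cons (IH (F \o cons y)) -deriv_wordZ -deriv_wordB.
exact: eq_deriv_wordr.
Qed.

(** Two letters leave the word in either order; the letter leaving second is shifted by one place in
    exactly one of the two orders, whence the sign. *)
Lemma deriv_word_anticomm phi psi f s :
  deriv_word phi (deriv_word psi f) s = - deriv_word psi (deriv_word phi f) s.
Proof.
elim: s f => [|y s IH] f; first by rewrite !deriv_word_nil oppr0.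
have e phi' psi' : deriv_word phi' (deriv_word psi' f) (y :: s) =
    phi' y *: deriv_word psi' f s - psi' y *: deriv_word phi' f s
    + deriv_word phi' (deriv_word psi' (f \o cons y)) s.
  rewrite deriv_word_cons -addrA; congr (_ + _); rewrite addrC -opprB; congr (- _).
  by rewrite -deriv_wordZ -deriv_wordB; exact: eq_deriv_wordr.
by rewrite !e IH opprD opprB.
Qed.

Lemma deriv_word_vanish phi f (P : pred X) s :
  (forall y, P y -> phi y = 0) -> all P s -> deriv_word phi f s = 0.
Proof.
move=> P0; elim: s f => // y s IH f /andP[/P0 phi0 /IH Ps].
by rewrite deriv_word_cons phi0 Ps scale0r subr0.
Qed.

Lemma deriv_word_sign phi f s :
  deriv_word phi (fun t => (-1) ^+ size t *: f t) s =
  - ((-1) ^+ size s *: deriv_word phi f s).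
Proof.
elim: s f => [|y s IH] f; first by rewrite !deriv_word_nil scaler0 oppr0.
rewrite !deriv_word_cons /= exprS mulN1r scaleNr opprK scalerBr !scalerA mulrC.
congr (_ - _).
rewrite -[RHS]opprK -(IH (f \o cons y)) -deriv_wordN; apply: eq_deriv_wordr => t /=.
by rewrite exprS mulN1r scaleNr.
Qed.

Lemma deriv_wordE phi f s x0 :
  deriv_word phi f s = \sum_(i < size s)
    ((-1) ^+ i * phi (nth x0 s i)) *: f (take i s ++ drop i.+1 s).
Proof.
elim: s f => [|y s IH] f; first by rewrite big_ord0.
rewrite big_ord_recl /= expr0 mul1r drop0 deriv_word_cons (IH (f \o cons y)) -sumrN.
congr (_ + _); apply: eq_bigr => i _ /=.
by rewrite -scaleNr exprS mulN1r mulNr.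
Qed.

Variable kappa : X -> X -> K.

(* [contract s f t] is the value of [f], extended linearly, at the signed sum of all
   words obtained from [s ++ t] by contracting letters of [s] with letters of [t]. *)
Fixpoint contract s f t : V :=
  if s is x :: s' then
    contract s' (f \o cons x) t
    + (-1) ^+ size s' *: deriv_word (kappa x) (contract s' f) t
  else f t.

Lemma contract_cons x s f t :
  contract (x :: s) f t = contract s (f \o cons x) t
    + (-1) ^+ size s *: deriv_word (kappa x) (contract s f) t.
Proof. by []. Qed.

Arguments contract : simpl never.

Lemma eq_contract s f g t : f =1 g -> contract s f t = contract s g t.
Proof.
elim: s f g t => [|x s IH] f g t fg; first exact: fg.
rewrite !contract_cons; congr (_ + _ *: _); first by apply: IH => u; exact: fg.
by apply: eq_deriv_wordr => u; exact: IH.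
Qed.

Lemma contractD s f g t :
  contract s (fun u => f u + g u) t = contract s f t + contract s g t.
Proof.
elim: s f g t => // x s IH f g t.
rewrite !contract_cons -(addrACA (contract s (f \o cons x) t)) -IH -scalerDr.
by congr (_ + _ *: _); rewrite -deriv_wordD; apply: eq_deriv_wordr => u.
Qed.

Lemma contractZ s c f t : contract s (fun u => c *: f u) t = c *: contract s f t.
Proof.
elim: s f t => // x s IH f t.
rewrite !contract_cons scalerDr -IH scalerA mulrC -scalerA -deriv_wordZ.
by congr (_ + _ *: _); apply: eq_deriv_wordr => u.
Qed.

Lemma contractB s f g t :
  contract s (fun u => f u - g u) t = contract s f t - contract s g t.
Proof.
by rewrite -scaleN1r -contractZ -contractD; apply: eq_contract => u; rewrite scaleN1r.
Qed.

(** Transposed Leibniz rule: an antiderivation of words is also an antiderivation of the contracted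
    product, iota(w * w') = (iota w) * w' + (-1)^|w| w * (iota w'). *)
Lemma contract_deriv phi s f t :
  contract s (deriv_word phi f) t =
  deriv_word phi (fun u => contract u f t) s
  + (-1) ^+ size s *: deriv_word phi (contract s f) t.
Proof.
elim: s f t => [|y s IH] f t; first by rewrite deriv_word_nil add0r scale1r.
set e : K := (-1) ^+ size s.
have ee (v : V) : e *: (e *: v) = v by rewrite scalerA -expr2 sqrr_sign scale1r.
have -> : contract (y :: s) (deriv_word phi f) t = phi y *: contract s f t
    - (deriv_word phi (fun u => contract u (f \o cons y) t) s
       + e *: deriv_word phi (contract s (f \o cons y)) t)
    + e *: deriv_word (kappa y) (fun v => deriv_word phi (fun u => contract u f v) s) t
    - deriv_word phi (deriv_word (kappa y) (contract s f)) t.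
  rewrite contract_cons -/e (eq_deriv_wordr _ _ (IH f)) deriv_wordD deriv_wordZ.
  (* In one term [phi] and [kappa y] both act on [t]; interchanging them gives the negative sign of
     the last summand. *)
  rewrite deriv_word_anticomm scalerDr ee addrA -IH -contractZ -contractB.
  by congr (_ + _ + _); exact: eq_contract.
have -> : deriv_word phi (contract (y :: s) f) t =
    deriv_word phi (contract s (f \o cons y)) t
    + e *: deriv_word phi (deriv_word (kappa y) (contract s f)) t.
  by rewrite -deriv_wordZ -deriv_wordD; exact: eq_deriv_wordr.
have -> : deriv_word phi (fun u => contract u f t) (y :: s) =
    phi y *: contract s f t
    - deriv_word phi (fun u => contract u (f \o cons y) t) s
    + e *: deriv_word (kappa y) (fun v => deriv_word phi (fun u => contract u f v) s) t.
  rewrite deriv_word_cons -deriv_word_exchange -[_ *: deriv_word _ _ s]opprK.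
  (* The word [u] left by the antiderivation has one letter less than [s], so its sign is opposite
     to that of [s]. *)
  rewrite -deriv_word_sign -addrA -opprD -deriv_wordD.
  by congr (_ - _); exact: eq_deriv_wordr.
rewrite /= exprS mulN1r -/e scaleNr scalerDr ee !opprD !addrA.
by congr (_ - _); rewrite [RHS]addrAC.
Qed.

(** Transposed as it is, the composite lets the antiderivation of index 0 act on the word before all
    others. *)
Fixpoint deriv_words k : ('I_k -> X -> K) -> (seq X -> V) -> seq X -> V :=
  if k is k'.+1 return ('I_k -> X -> K) -> (seq X -> V) -> seq X -> V
  then fun Phi f => deriv_word (Phi ord0) (deriv_words (Phi \o lift ord0) f)
  else fun=> id.

Lemma deriv_wordsS k (phi : 'I_k.+1 -> X -> K) f :
  deriv_words phi f = deriv_word (phi ord0) (deriv_words (phi \o lift ord0) f).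
Proof. by []. Qed.

Lemma eq_deriv_words k (phi psi : 'I_k -> X -> K) f g :
  (forall i, phi i =1 psi i) -> f =1 g -> deriv_words phi f =1 deriv_words psi g.
Proof.
elim: k phi psi => [|k IH] phi psi e fg t; first exact: fg.
by rewrite !deriv_wordsS; apply: eq_deriv_word => // u; apply: IH => // i; exact: e.
Qed.

Lemma deriv_word_sum phi (I : Type) (r : seq I) (P : pred I) (F : I -> seq X -> V) s :
  deriv_word phi (fun t => \sum_(i <- r | P i) F i t) s =
  \sum_(i <- r | P i) deriv_word phi (F i) s.
Proof.
elim: r => [|i r IH].
  rewrite big_nil -[RHS](scale0r (deriv_word phi (fun=> 0) s)) -deriv_wordZ.
  by apply: eq_deriv_wordr => t; rewrite big_nil scaler0.
rewrite big_cons -IH; case: ifPn => Pi.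
  by rewrite -deriv_wordD; apply: eq_deriv_wordr => t; rewrite big_cons Pi.
by apply: eq_deriv_wordr => t; rewrite big_cons (negbTE Pi).
Qed.

(** At most one antiderivation removes [y]. If it is the i-th, the i that act earlier have passed
    over [y], each with a sign; if none does, all k+1 pass over it. This is the source of the
    expansion of determinants along the first column. *)
Lemma deriv_words_cons k (phi : 'I_k.+1 -> X -> K) f y t :
  deriv_words phi f (y :: t) =
  \sum_(i < k.+1) ((-1) ^+ i * phi i y) *: deriv_words (phi \o lift i) f t
  + (-1) ^+ k.+1 *: deriv_words phi (f \o cons y) t.
Proof.
elim: k phi t => [|k IH] phi t.
  by rewrite big_ord1 mul1r scaleN1r.
rewrite deriv_wordsS deriv_word_cons.
rewrite (eq_deriv_wordr _ _ (IH (phi \o lift ord0))).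
rewrite deriv_wordD deriv_wordZ -deriv_wordsS opprD addrA.
rewrite -[- (_ *: _)]scaleN1r scalerA -exprS.
congr (_ + _); rewrite [RHS]big_ord_recl mul1r; congr (_ + _).
rewrite deriv_word_sum -sumrN; apply: eq_bigr => i _.
rewrite deriv_wordZ lift0 exprS mulN1r mulNr scaleNr; congr (- (_ *: _)).
rewrite deriv_wordsS; apply: eq_deriv_word => [x /=|].
  by congr (phi _ _); apply/val_inj.
apply: eq_deriv_words => // j x /=; congr (phi _ _); apply/val_inj => /=.
by rewrite /bump /=; case: leqP => /=; lia.
Qed.

End Contraction.
Arguments deriv_word : simpl never.
Arguments contract : simpl never.
Arguments deriv_words : simpl never.

(** * Sums over increasing sequences *)

Section Increasing.

Lemma increasingP k n (i : {ffun 'I_k -> 'I_n}) :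
  reflect (forall x y : 'I_k, (x < y)%N -> (i x < i y)%N) (increasing i).
Proof.
apply: (iffP forallP) => [H x y xy|H x].
  by have /forallP/(_ y)/implyP := H x; exact.
by apply/forallP => y; apply/implyP; exact: H.
Qed.

Lemma increasing_leq k n (i : {ffun 'I_k -> 'I_n}) : increasing i -> (k <= n)%N.
Proof.
move=> /increasingP inc; rewrite -[k]card_ord -[n]card_ord; apply: (leq_card i) => x y exy.
by apply/val_inj; case: (ltngtP x y) => // /inc; rewrite exy ltnn.
Qed.

Definition cons0_ffun k n (i : {ffun 'I_k -> 'I_n}) : {ffun 'I_k.+1 -> 'I_n.+1} :=
  [ffun x => if unlift ord0 x is Some y then lift ord0 (i y) else ord0].

Definition lift0_ffun k n (i : {ffun 'I_k -> 'I_n}) : {ffun 'I_k -> 'I_n.+1} :=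
  [ffun x => lift ord0 (i x)].

Lemma cons0_ffun0 k n (i : {ffun 'I_k -> 'I_n}) : cons0_ffun i ord0 = ord0.
Proof. by rewrite ffunE unlift_none. Qed.

Lemma cons0_ffunS k n (i : {ffun 'I_k -> 'I_n}) x :
  cons0_ffun i (lift ord0 x) = lift ord0 (i x).
Proof. by rewrite ffunE liftK. Qed.

Lemma cons0_ffun_inj k n : injective (@cons0_ffun k n).
Proof.
move=> i j /ffunP e; apply/ffunP => x; apply: (@lift_inj _ ord0).
by rewrite -!cons0_ffunS e.
Qed.

Lemma lift0_ffun_inj k n : injective (@lift0_ffun k n).
Proof.
move=> i j /ffunP e; apply/ffunP => x; apply: (@lift_inj _ ord0).
by have := e x; rewrite !ffunE.
Qed.

Lemma increasing_cons0 k n (i : {ffun 'I_k -> 'I_n}) :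
  increasing (cons0_ffun i) = increasing i.
Proof.
apply/increasingP/increasingP => H x y.
  by move=> xy; have := H (lift ord0 x) (lift ord0 y); rewrite !cons0_ffunS !lift0 !ltnS; exact.
case: (unliftP ord0 x) => [x'|] ->; case: (unliftP ord0 y) => [y'|] -> //.
  by rewrite !cons0_ffunS !lift0 !ltnS; exact: H.
by rewrite cons0_ffun0 cons0_ffunS.
Qed.

Lemma increasing_lift0 k n (i : {ffun 'I_k -> 'I_n}) :
  increasing (lift0_ffun i) = increasing i.
Proof.
by apply/increasingP/increasingP => H x y /H; rewrite !ffunE !lift0 !ltnS.
Qed.

Lemma lift0_exists k n (i : {ffun 'I_k -> 'I_n.+1}) :
  (forall x, i x != ord0) -> exists j, lift0_ffun j = i.
Proof.
move=> i0; have [x|j ij] := fin_all_exists (P := fun x u => i x = lift ord0 u).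
  by case: (unliftP ord0 (i x)) (i0 x) => [u ->|->]; [exists u|rewrite eqxx].
by exists (finfun j); apply/ffunP => x; rewrite !ffunE.
Qed.

Lemma reindex_inj_on (V : nmodType) (I J : finType) (P : pred I) (h : J -> I) (F : I -> V) :
  injective h -> (forall i, P i -> exists j, h j = i) ->
  \sum_(i | P i) F i = \sum_(j | P (h j)) F (h j).
Proof.
move=> h_inj h_surj.
rewrite (reindex_omap (op := +%R) h (fun i => [pick j | h j == i])) /=.
  apply: eq_bigl => j; case: pickP => [u /eqP/h_inj ->|/(_ j)]; last by rewrite eqxx.
  by rewrite eqxx andbT.
move=> i /h_surj[j hj]; case: pickP => [u /eqP /= ->|/(_ j)] //.
by rewrite hj eqxx.
Qed.

(** Pascal's rule: an increasing map either starts at 0 or avoids 0 altogether. Both expansions into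
    minors are inductions along this splitting, with 0 the index of the leftmost letter. *)
Lemma sum_increasingS (V : zmodType) k n (F : {ffun 'I_k.+1 -> 'I_n.+1} -> V) :
  \sum_(i | increasing i) F i =
  \sum_(i : {ffun 'I_k -> 'I_n} | increasing i) F (cons0_ffun i)
  + \sum_(i | increasing i) F (lift0_ffun i).
Proof.
rewrite (bigID [pred i : {ffun 'I_k.+1 -> 'I_n.+1} | i ord0 == ord0]) /=; congr (_ + _).
  rewrite (reindex_inj_on (h := @cons0_ffun k n)) /=; last first.
  - move=> i /andP[/increasingP inc /eqP i0].
    have [x|j /ffunP ij] := @lift0_exists _ _ [ffun x => i (lift ord0 x)].
      by rewrite ffunE -val_eqE -lt0n -[X in (X < _)%N]/(val (@ord0 n)) -i0 inc.
    exists j; apply/ffunP => x; case: (unliftP ord0 x) => [y|] ->.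
      by have := ij y; rewrite cons0_ffunS !ffunE.
    by rewrite cons0_ffun0 i0.
  - exact: cons0_ffun_inj.
  by apply: eq_bigl => i; rewrite increasing_cons0 cons0_ffun0 eqxx andbT.
rewrite (reindex_inj_on (h := @lift0_ffun k.+1 n)) /=; last first.
- move=> i /andP[/increasingP inc i0]; apply: lift0_exists => x.
  rewrite -val_eqE -lt0n; case: (unliftP ord0 x) => [y|] ->; last by rewrite lt0n.
  by apply: leq_ltn_trans (inc ord0 (lift ord0 y) _).
- exact: lift0_ffun_inj.
by apply: eq_bigl => i; rewrite increasing_lift0 ffunE andbT.
Qed.

Lemma sum_increasing0 (V : nmodType) n (F : {ffun 'I_0 -> 'I_n} -> V) i :
  \sum_(i | increasing i) F i = F i.
Proof.
rewrite (big_pred1 i) // => j; have -> : j = i by apply/ffunP => -[].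
by rewrite /= eqxx; apply/increasingP => -[].
Qed.

Lemma sum_increasing_gt (V : nmodType) k n (F : {ffun 'I_k -> 'I_n} -> V) :
  (n < k)%N -> \sum_(i | increasing i) F i = 0.
Proof.
by move=> nk; apply: big1 => i /increasing_leq; rewrite leqNgt nk.
Qed.

Definition omit (T : Type) k n (b : 'I_n -> T) (i : {ffun 'I_k -> 'I_n}) : seq T :=
  [seq b l | l <- enum 'I_n & l \notin codom i].

Lemma codom_lift0 k n (i : {ffun 'I_k -> 'I_n}) x :
  (lift ord0 x \in codom (lift0_ffun i)) = (x \in codom i).
Proof.
apply/codomP/codomP => -[y]; first by rewrite ffunE => /lift_inj ->; exists y.
by move=> ->; exists y; rewrite ffunE.
Qed.

Lemma codom_cons0 k n (i : {ffun 'I_k -> 'I_n}) x :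
  (lift ord0 x \in codom (cons0_ffun i)) = (x \in codom i).
Proof.
apply/codomP/codomP => -[y].
  case: (unliftP ord0 y) => [z|] ->; last by rewrite cons0_ffun0 => /(congr1 val).
  by rewrite cons0_ffunS => /lift_inj ->; exists z.
by move=> ->; exists (lift ord0 y); rewrite cons0_ffunS.
Qed.

Lemma omit_cons0 (T : Type) k n (b : 'I_n.+1 -> T) (i : {ffun 'I_k -> 'I_n}) :
  omit b (cons0_ffun i) = omit (b \o lift ord0) i.
Proof.
rewrite /omit enum_ordSl /= ifF; last first.
  by apply/negbTE; rewrite negbK; apply/codomP; exists ord0; rewrite cons0_ffun0.
rewrite filter_map -map_comp; congr map; apply: eq_filter => x /=.
by rewrite codom_cons0.
Qed.

Lemma omit_lift0 (T : Type) k n (b : 'I_n.+1 -> T) (i : {ffun 'I_k -> 'I_n}) :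
  omit b (lift0_ffun i) = b ord0 :: omit (b \o lift ord0) i.
Proof.
rewrite /omit enum_ordSl /= ifT; last first.
  by apply/negP => /codomP[x]; rewrite ffunE => /(congr1 val).
rewrite /= filter_map -map_comp; congr (_ :: map _ _); apply: eq_filter => x /=.
by rewrite codom_lift0.
Qed.

Lemma omit_ffun0 (T : Type) n (b : 'I_n -> T) (i : {ffun 'I_0 -> 'I_n}) :
  omit b i = [seq b l | l <- enum 'I_n].
Proof.
rewrite /omit (eq_filter (a2 := predT)) ?filter_predT // => x /=.
by apply/negP => /codomP[] [].
Qed.

End Increasing.

(** * Expansion of contractions into determinants *)

Section Expansion.
Variables (K : comNzRingType) (X : Type) (V : lmodType K).
Implicit Types (f : seq X -> V).

(** Induction on the word: if its first letter is removed, [deriv_words_cons] is the cofactor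
    expansion along column 0; if it stays, all k antiderivations pass over it and every index grows
    by one. *)
Lemma deriv_wordsE k n (phi : 'I_k -> X -> K) f (b : 'I_n -> X) :
  deriv_words phi f [seq b l | l <- enum 'I_n] =
  \sum_(j : {ffun 'I_k -> 'I_n} | increasing j)
    ((-1) ^+ (\sum_l (j l + l)) * \det (\matrix_(x < k, l < k) phi x (b (j l))))
      *: f (omit b j).
Proof.
elim: n k phi f b => [|n IH] [|k] phi f b.
- rewrite (sum_increasing0 _ (ffun0 (card_ord 0))) big_ord0 det_mx00 mul1r scale1r.
  by rewrite omit_ffun0.
- by rewrite sum_increasing_gt // enum_ord0.
- pose i : {ffun 'I_0 -> 'I_n.+1} := ffun0 (card_ord 0).
  by rewrite (sum_increasing0 _ i) big_ord0 det_mx00 mul1r scale1r omit_ffun0.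
rewrite enum_ordSl [map _ _]/= -map_comp deriv_words_cons sum_increasingS.
under eq_bigr => i _ do rewrite IH scaler_sumr.
rewrite IH scaler_sumr exchange_big /=; congr (_ + _); apply: eq_bigr => j _.
  under eq_bigr => i _ do rewrite scalerA.
  rewrite omit_cons0 -scaler_suml; congr (_ *: _).
  rewrite (expand_det_col _ ord0) mulr_sumr; apply: eq_bigr => i _.
  rewrite !mxE cons0_ffun0 /cofactor addn0 mulrACA mulrC.
  rewrite big_ord_recl cons0_ffun0 add0n.
  have -> : (\sum_(l < k) (cons0_ffun j (lift ord0 l) + lift ord0 l) =
      \sum_(l < k) (j l + l) + k.*2)%N.
    under eq_bigr => l _ do rewrite cons0_ffunS !lift0 addSn addnS -addn2.
    by rewrite big_split /= sum_nat_const card_ord muln2.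
  rewrite exprD -(signr_odd _ k.*2) odd_double mulr1.
  rewrite [RHS]mulrCA -mulrA; congr (_ * _); rewrite [RHS]mulrCA mulrC -!mulrA.
  congr (_ * (_ * _)); congr (\det _); apply/matrixP => x l.
  by rewrite !mxE cons0_ffunS.
rewrite omit_lift0 scalerA mulrA -exprD; congr ((_ * _) *: _).
  rewrite -signr_odd -[RHS]signr_odd; congr (_ ^+ (nat_of_bool _)).
  under [in RHS]eq_bigr => l _ do rewrite ffunE lift0 addSn -add1n.
  by rewrite [in RHS]big_split sum_nat_const card_ord muln1.
by congr (\det _); apply/matrixP => x l; rewrite !mxE ffunE.
Qed.

Variable kappa : X -> X -> K.

(** A contracted letter a_i brings one sign for each of the r - 1 - i letters to its right,
    contracted or not; this is the exponent, modulo 2. The bound [N] is left free because the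
    induction applies to the tail twice, with [N.+1] when the first letter stays and with [N] when
    it is contracted; surplus terms are empty sums. *)
Lemma contractE r N (a : 'I_r -> X) f t : (r < N)%N ->
  contract kappa [seq a l | l <- enum 'I_r] f t =
  \sum_(k < N) \sum_(i : {ffun 'I_k -> 'I_r} | increasing i)
    (-1) ^+ (\sum_x (i x).+1 + r * k) *:
      deriv_words (fun x => kappa (a (i x))) (f \o cat (omit a i)) t.
Proof.
elim: r N a f t => [|r IH] [|N] a f t // rN.
  rewrite big_ord_recl (sum_increasing0 _ (ffun0 (card_ord 0))) big_ord0 scale1r.
  rewrite big1 => [|k _]; last by rewrite sum_increasing_gt.
  by rewrite addr0 /= omit_ffun0 enum_ord0.
rewrite enum_ordSl [map _ _]/= -map_comp contract_cons.
rewrite (IH N.+1) ?(ltnW rN) // (eq_deriv_wordr _ _ (fun u => IH N (a \o lift ord0) f u rN)).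
rewrite deriv_word_sum scaler_sumr !big_ord_recl.
pose i0 n : {ffun 'I_0 -> 'I_n} := ffun0 (card_ord 0).
rewrite (sum_increasing0 _ (i0 r)) (sum_increasing0 _ (i0 r.+1)) !big_ord0 !muln0 !scale1r.
rewrite -addrA; congr (_ + _).
  by rewrite /= !omit_ffun0 enum_ordSl /= -map_comp.
rewrite -big_split; apply: eq_bigr => k _ /=; rewrite addrC sum_increasingS.
rewrite deriv_word_sum scaler_sumr; congr (_ + _); apply: eq_bigr => i _.
  rewrite deriv_wordZ scalerA -exprD omit_cons0; congr (_ *: _).
    rewrite big_ord_recl cons0_ffun0.
    under [in RHS]eq_bigr => x _ do rewrite cons0_ffunS lift0 -addn1.
    rewrite [in RHS]big_split /= sum_nat_const card_ord muln1 -signr_odd -[RHS]signr_odd.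
    rewrite size_map size_enum_ord; congr (_ ^+ (nat_of_bool _)).
    by rewrite !(oddD, oddM, oddS) /=; lia.
  rewrite deriv_wordsS cons0_ffun0; apply: eq_deriv_wordr.
  by apply: eq_deriv_words => // x y /=; rewrite cons0_ffunS.
congr (_ *: _).
  under [in RHS]eq_bigr => x _ do rewrite ffunE lift0 -addn1.
  rewrite [in RHS]big_split /= sum_nat_const card_ord muln1 -signr_odd -[RHS]signr_odd.
  by congr (_ ^+ (nat_of_bool _)); rewrite !(oddD, oddM) /=; lia.
by apply: eq_deriv_words => [x y /=|u /=]; rewrite ?ffunE ?omit_lift0.
Qed.

End Expansion.

Section LinearImage.
Variables (K : comNzRingType) (X : Type) (V V' : lmodType K) (L : V -> V').
Hypothesis L_lin : linear L.

Lemma linear_map0 : L 0 = 0.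
Proof. by have := L_lin (-1) 0 0; rewrite scaleN1r oppr0 addr0 scaleN1r addNr. Qed.

Lemma linear_mapZ c u : L (c *: u) = c *: L u.
Proof. by have := L_lin c u 0; rewrite linear_map0 !addr0. Qed.

Lemma linear_mapD u v : L (u + v) = L u + L v.
Proof. by have := L_lin 1 u v; rewrite !scale1r. Qed.

Lemma linear_mapB u v : L (u - v) = L u - L v.
Proof. by rewrite -scaleN1r linear_mapD linear_mapZ scaleN1r. Qed.

Lemma deriv_word_map phi f (s : seq X) :
  deriv_word phi (L \o f) s = L (deriv_word phi f s).
Proof.
elim: s f => [|y s IH] f; first by rewrite !deriv_word_nil linear_map0.
by rewrite !deriv_word_cons linear_mapB linear_mapZ /= -(IH (f \o cons y)).
Qed.

Lemma contract_map kappa (s : seq X) f t :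
  contract kappa s (L \o f) t = L (contract kappa s f t).
Proof.
elim: s f t => // x s IH f t.
rewrite !contract_cons linear_mapD linear_mapZ -(IH (f \o cons x)) -deriv_word_map.
by congr (_ + _ *: _); apply: eq_deriv_wordr => u; exact: IH.
Qed.

End LinearImage.

(** * Wick's theorem for operators obeying the one-letter rule *)

Section Operators.
Variables (K : comNzRingType) (X : Type) (W : lmodType K).
Implicit Types (f : seq X -> W -> W) (s t : seq X).

Lemma comp_linearl (e : W -> W) : linear e -> linear (fun g : W -> W => e \o g).
Proof. by move=> e_lin c g g'; apply/funext => w /=; exact: e_lin. Qed.

Lemma comp_linearr (e : W -> W) : linear (fun g : W -> W => g \o e).
Proof. by []. Qed.

Variables (kappa : X -> X -> K) (e : X -> W -> W) (N : seq X -> W -> W).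
Hypothesis e_lin : forall x, linear (e x).
Hypothesis N_nil : N [::] = idfun.
Hypothesis N_cons : forall x s,
  N (x :: s) = e x \o N s - deriv_word (kappa x) N s.

Lemma contract_comp s t : contract kappa s N t = N s \o N t.
Proof.
(* The induction is on length, since omitting a letter of [s] does not leave a tail of [s]. *)
elim: {s}(size s) {-2}s (leqnn (size s)) => [|n IH] [|x s] // sn; rewrite ?N_nil //.
have ex : contract kappa s (N \o cons x) t =
    contract kappa s (fun u => e x \o N u - deriv_word (kappa x) N u) t.
  by apply: eq_contract => u; exact: N_cons.
rewrite contract_cons ex contractB contract_deriv.
(* By the Leibniz rule, the correction term of [N_cons] produces the contractions of [x] with [t]
   with a negative sign, and these cancel the ones in [contract_cons]. Only the contractions of [x]
   with [s] survive. *)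
rewrite (contract_map (comp_linearl (e_lin x)) kappa s N t) IH // opprD addrA subrK N_cons.
rewrite (eq_deriv_word_size _ (g := (fun h => h \o N t) \o N)) => [|u us].
  by rewrite (deriv_word_map (comp_linearr (N t))).
by apply: IH; apply: leq_trans (ltnW us) sn.
Qed.

Lemma wick r n (a : 'I_r -> X) (b : 'I_n -> X) :
  N [seq a i | i <- enum 'I_r] \o N [seq b j | j <- enum 'I_n] =
  N ([seq a i | i <- enum 'I_r] ++ [seq b j | j <- enum 'I_n])
  + \sum_(1 <= rho < (minn r n).+1)
      \sum_(i : {ffun 'I_rho -> 'I_r} | increasing i)
      \sum_(j : {ffun 'I_rho -> 'I_n} | increasing j)
        ((-1) ^+ (\sum_k (i k).+1 + \sum_k (j k).+1)
         * (-1) ^+ (r * rho + (rho * rho.+1) %/ 2)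
         * \det (\matrix_(k < rho, l < rho) kappa (a (i k)) (b (j l))))
        *: N (omit a i ++ omit b j).
Proof.
rewrite -contract_comp (contractE _ _ _ _ (ltnSn r)).
rewrite -(big_mkord xpredT (fun k => \sum_(i : {ffun 'I_k -> 'I_r} | increasing i)
  (-1) ^+ (\sum_x (i x).+1 + r * k) *: deriv_words (fun x => kappa (a (i x)))
     (N \o cat (omit a i)) [seq b j | j <- enum 'I_n])).
rewrite big_ltn // (sum_increasing0 _ (ffun0 (card_ord 0))) big_ord0 muln0 scale1r.
rewrite /= omit_ffun0; congr (_ + _).
(* Beyond the minimum of r and n there is no increasing choice of letters in the second word. *)
rewrite (big_cat_nat (n := (minn r n).+1)) //= ?ltnS ?geq_minl //.
rewrite [X in _ + X]big_nat_cond [X in _ + X]big1 ?addr0 => [|k]; last first.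
  rewrite andbT => /andP[rsk kr]; apply: big1 => i _; rewrite deriv_wordsE.
  by rewrite sum_increasing_gt ?scaler0 //; lia.
apply: eq_bigr => k _; apply: eq_bigr => i _; rewrite deriv_wordsE scaler_sumr.
apply: eq_bigr => j _; rewrite scalerA mulrA -!exprD /=; congr ((_ * _) *: _).
rewrite -signr_odd -[RHS]signr_odd; congr (_ ^+ (nat_of_bool _)).
(* The term k(k+1)/2 comes from the column numbers in [deriv_wordsE], counted from 1 instead of 0;
   the shift of both j and l changes the exponent by the even number 2k. *)
have tri : (\sum_(l < k) l.+1 = (k * k.+1) %/ 2)%N.
  elim: k {i j} => [|k IH]; first by rewrite big_ord0.
  by rewrite big_ord_recr /= IH; lia.
have : (\sum_(l < k) (j l + l) + k.*2 = \sum_(l < k) (j l).+1 + \sum_(l < k) l.+1)%N.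
  rewrite -muln2 -[X in (X * 2)%N](card_ord k) -sum_nat_const -!big_split.
  by apply: eq_bigr => l _ /=; lia.
move=> /(congr1 odd); rewrite -tri !oddD odd_double addbF => ->.
by rewrite !addbA; congr (_ (+) _); rewrite addbAC.
Qed.

End Operators.

(** * Normal ordering *)

Section NormalOrderSign.
Variables (K : numFieldType) (h : lmodType K).
Implicit Types (x y : h * int) (s : seq (h * int)).

(* The position of [x] in the normal order of [x :: s]. *)
Definition nord_rank x s : nat :=
  if x.2 < 0 then 0%N else
  (count [pred y | (y.2 < 0)%R] s + (if (0 < x.2)%R then 0 else count [pred y | (0 < y.2)%R] s))%N.

(** The number of inversions: each letter counts the later letters that overtake it. *)
Fixpoint nord_inv s : nat :=
  if s is x :: s' then (nord_rank x s' + nord_inv s')%N else 0%N.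

Let sel (f : int -> bool) s : seq 'I_(size s) := [seq i <- enum 'I_(size s) | f (mode_index i)].

Let sel_cons f x s : sel f (x :: s) =
  (if f x.2 then cons ord0 else id) [seq lift ord0 i | i <- sel f s].
Proof.
rewrite /sel [enum _](enum_ordSl (size s)) /= filter_map.
have -> : mode_index (s := x :: s) ord0 = x.2 by rewrite /mode_index (tnth_nth x).
set a := [seq i <- enum _ | _]; set b := [seq i <- enum _ | f _].
have -> : a = b.
  by apply: eq_filter => i; rewrite /= /mode_index !(tnth_nth x).
by case: ifP.
Qed.

Let size_sel f s : size (sel f s) = count [pred y | f y.2] s.
Proof.
rewrite size_filter -[s in RHS]/(tval (in_tuple s)) -[in RHS](map_tnth_enum (in_tuple s)) count_map.
exact: eq_count.
Qed.

Let nord_seq_sel s : nord_seq s =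
  sel (fun m => m < 0) s ++ sel (fun m => 0 < m) s ++ sel (fun m => m == 0) s.
Proof. by []. Qed.

Lemma nord_seq_cons x s :
  nord_seq (x :: s) =
  take (nord_rank x s) [seq lift ord0 i | i <- nord_seq s] ++
  ord0 :: drop (nord_rank x s) [seq lift ord0 i | i <- nord_seq s].
Proof.
rewrite !nord_seq_sel !sel_cons /nord_rank !map_cat.
case: (ltgtP x.2 0) => _ /=; rewrite ?take0 ?drop0 //.
  by rewrite addn0 take_size_cat ?drop_size_cat // size_map size_sel.
rewrite !catA take_size_cat ?drop_size_cat // size_cat !size_map !size_sel //.
Qed.

Lemma nord_rank_le x s : (nord_rank x s <= size s)%N.
Proof.
rewrite /nord_rank; case: ifP => // _.
have := count_predC [pred y : h * int | y.2 < 0] s; set c := count _ s => <-.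
rewrite leq_add2l; case: ifP => // _; apply: sub_count => y /=.
by rewrite -leNgt; exact: ltW.
Qed.

(** A new leftmost letter comes first within its group, so it is inserted right after the groups
    that precede its own, and the order of the other letters is unchanged. *)
Lemma nord_perm_cons x s :
  nord_perm (x :: s) = lift_perm (inord (nord_rank x s) : 'I_(size s).+1) ord0 (nord_perm s).
Proof.
set p : 'I_(size s).+1 := inord _; have pE : p = nord_rank x s :> nat.
  by rewrite inordK // ltnS nord_rank_le.
have szs : size (nord_seq s) = size s.
  by rewrite (perm_size (nord_seq_perm s)) size_enum_ord.
apply/permP => k; rewrite permE /nord_fun nord_seq_cons -pE nth_cat size_take.
rewrite size_map szs; have := ltn_ord p; rewrite ltnS leq_eqVlt => hp.
have -> : (if (p < size s)%N then p : nat else size s) = p.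
  by case/orP: hp => [/eqP->|->]; rewrite ?ltnn.
case: (unliftP p k) => [j|] ->; last by rewrite lift_perm_id ltnn subnn.
rewrite lift_perm_lift permE /nord_fun /= /bump; case: (leqP p j) => pj.
  rewrite add1n ltnNge (leqW pj) /= subSn //= nth_drop subnKC //.
  by rewrite (nth_map j) // szs.
rewrite add0n pj nth_take // (nth_map j) // szs.
by rewrite (leq_trans pj) // -ltnS ltn_ord.
Qed.

Lemma odd_nord_perm s : odd_perm (nord_perm s) = odd (nord_inv s).
Proof.
elim: s => [|x s IH].
  by rewrite (_ : nord_perm _ = 1%g) ?odd_perm1 //; apply/permP => -[].
rewrite nord_perm_cons [odd_perm _]odd_lift_perm IH /= oddD inordK ?addbF //.
by rewrite ltnS nord_rank_le.
Qed.

End NormalOrderSign.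

Section MapWord.
Variables (K : comNzRingType) (X Y : Type) (V : lmodType K).

(** Agreement is asked on [P] only: it is applied to words of zero modes, where the mode index is
    forgotten. *)
Lemma deriv_word_mapl (P : pred X) (g : X -> Y) phi psi (f : seq Y -> V) (s : seq X) :
  (forall x, P x -> phi x = psi (g x)) -> all P s ->
  deriv_word phi (f \o map g) s = deriv_word psi f (map g s).
Proof.
move=> e; elim: s f => // x s IH f /andP[/e xe Ps].
by rewrite /= !deriv_word_cons xe -(IH (f \o cons (g x))).
Qed.

End MapWord.

(** * Antiderivations of words sorted into normal order *)

Section SortedWord.
Variables (K : numFieldType) (h : lmodType K) (V : lmodType K).
Implicit Types (x y : h * int) (n p z s : seq (h * int)).
Implicit Types (g : seq (h * int) -> seq (h * int) -> seq (h * int) -> V).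

Definition neg_part s := [seq x <- s | x.2 < 0].
Definition pos_part s := [seq x <- s | x.2 > 0].
Definition zero_part s := [seq x <- s | x.2 == 0].

Lemma count_neg s : count [pred y | y.2 < 0] s = size (neg_part s).
Proof. by rewrite size_filter. Qed.

Lemma count_pos s : count [pred y | 0 < y.2] s = size (pos_part s).
Proof. by rewrite size_filter. Qed.

(** The function [g] of the three groups is arbitrary so that a prepended letter, with its sign, can
    be absorbed into [g] in inductions on [s]. *)
Definition sorted_word g s : V :=
  (-1) ^+ nord_inv s *: g (neg_part s) (pos_part s) (zero_part s).

Lemma sorted_word_neg g y s : y.2 < 0 ->
  sorted_word g (y :: s) = sorted_word (fun n p z => g (y :: n) p z) s.
Proof.
move=> y0; rewrite /sorted_word /= /nord_rank y0 ltNge (ltW y0) /= lt_eqF //.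
Qed.

Lemma sorted_word_pos g y s : 0 < y.2 ->
  sorted_word g (y :: s) =
  sorted_word (fun n p z => (-1) ^+ size n *: g n (y :: p) z) s.
Proof.
move=> y0; rewrite /sorted_word /= /nord_rank y0 ltNge (ltW y0) /= gt_eqF //=.
by rewrite addn0 count_neg scalerA exprD mulrC.
Qed.

Lemma sorted_word_zero g y s : y.2 = 0 ->
  sorted_word g (y :: s) =
  sorted_word (fun n p z => (-1) ^+ (size n + size p) *: g n p (y :: z)) s.
Proof.
move=> y0; rewrite /sorted_word /= /nord_rank y0 ltxx eqxx /=.
by rewrite ?count_neg ?count_pos scalerA [in LHS]exprD mulrC.
Qed.

(** The place of a negative letter in [s] exceeds its place among the negative letters by the number
    of inversions it takes part in. These are exactly the inversions lost when it is removed, so the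
    sign of the whole word factors out. *)
Lemma deriv_sorted_neg phi g s : (forall y, 0 <= y.2 -> phi y = 0) ->
  deriv_word phi (sorted_word g) s =
  (-1) ^+ nord_inv s *:
    deriv_word phi (fun n => g n (pos_part s) (zero_part s)) (neg_part s).
Proof.
move=> phi0; elim: s g => [|y s IH] g.
  by rewrite !deriv_word_nil scaler0.
rewrite deriv_word_cons /= /nord_rank; case: (ltgtP y.2 0) => y0.
- rewrite (eq_deriv_wordr _ _ (fun t => sorted_word_neg g t y0)) IH.
  by rewrite deriv_word_cons add0n scalerBr scalerA mulrC -scalerA.
- rewrite phi0 ?(ltW y0) // scale0r sub0r.
  rewrite (eq_deriv_wordr _ _ (fun t => sorted_word_pos g t y0)) IH.
  rewrite (deriv_word_sign _ (fun n => g n _ _)) scalerN opprK scalerA -exprD.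
  by rewrite addn0 addnC count_neg.
- rewrite phi0 ?y0 // scale0r sub0r.
  rewrite (eq_deriv_wordr _ _ (fun t => sorted_word_zero g t y0)) IH.
  rewrite (eq_deriv_wordr _ (g := fun n => (-1) ^+ size (pos_part s) *:
     ((-1) ^+ size n *: g n (pos_part s) (y :: zero_part s)))); last first.
    by move=> n; rewrite scalerA -exprD addnC.
  rewrite deriv_wordZ (deriv_word_sign _ (fun n => g n _ _)) !scalerN opprK !scalerA -!exprD.
  by rewrite count_neg count_pos addnC (addnC (nord_inv s)) addnA.
Qed.

(** For a zero mode the shift of place counts the nonzero letters before it, and the lost inversions
    are the nonzero letters after it. Together they are all nonzero letters, which gives the extra
    sign. *)
Lemma deriv_sorted_zero phi g s : (forall y, y.2 != 0 -> phi y = 0) ->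
  deriv_word phi (sorted_word g) s =
  (-1) ^+ (nord_inv s + (size (neg_part s) + size (pos_part s))) *:
    deriv_word phi (g (neg_part s) (pos_part s)) (zero_part s).
Proof.
move=> phi0; elim: s g => [|y s IH] g.
  by rewrite !deriv_word_nil scaler0.
rewrite deriv_word_cons /= /nord_rank; case: (ltgtP y.2 0) => y0.
- rewrite phi0 ?lt_eqF // scale0r sub0r.
  rewrite (eq_deriv_wordr _ _ (fun t => sorted_word_neg g t y0)) IH.
  by rewrite add0n /= addSn addnS exprS mulN1r scaleNr.
- rewrite phi0 ?gt_eqF // scale0r sub0r.
  rewrite (eq_deriv_wordr _ _ (fun t => sorted_word_pos g t y0)) IH deriv_wordZ scalerA.
  rewrite -scaleNr -mulN1r -!exprD -exprS /= count_neg; congr (_ ^+ _ *: _).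
  by move: (nord_inv s) (size (neg_part s)) (size (pos_part s)) => i n p; lia.
- rewrite (eq_deriv_wordr _ _ (fun t => sorted_word_zero g t y0)) IH deriv_wordZ.
  rewrite deriv_word_cons scalerBr /sorted_word count_neg count_pos.
  rewrite !scalerA -exprD mulrC; congr ((_ * _) *: _ - _ *: _);
    rewrite -signr_odd -[RHS]signr_odd; congr (_ ^+ (nat_of_bool _));
    by move: (nord_inv s) (size (neg_part s)) (size (pos_part s)) => i n p; lia.
Qed.

End SortedWord.

Definition mode_pairing (K : numFieldType) (m n : int) : K :=
  (m + n == 0)%:R * (if 0 < m then 1 else if m == 0 then 2^-1 else 0).

(** * The one-letter rule for normal ordering *)

Section NordRecursion.
Variables (K : numFieldType) (h : lmodType K) (form : h -> h -> K).
Variables (W : lmodType K) (md : h -> int -> W -> W).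

(* Normal ordering with operators [md a n] on an arbitrary module in place of the
   modes on [spaceW]. *)
Fixpoint nord0_rec_of (k : nat) (s : seq h) : W -> W :=
  match k, s with
  | k'.+1, a :: s' =>
      (md a 0 \o nord0_rec_of k' s')
      + \sum_(i < size s') ((-1) ^+ i.+3 / 2 * form a (nth 0 s' i))
                             *: nord0_rec_of k' (take i s' ++ drop i.+1 s')
  | _, _ => idfun
  end.

Definition nord0_of (s : seq h) : W -> W := nord0_rec_of (size s) s.

Definition prod_modes_of (l : seq (h * int)) : W -> W :=
  foldr (fun x f => md x.1 x.2 \o f) idfun l.

Definition sorted_modes (n p z : seq (h * int)) : W -> W :=
  prod_modes_of n \o prod_modes_of p \o nord0_of [seq x.1 | x <- z].

Definition nord_of : seq (h * int) -> W -> W := sorted_word sorted_modes.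

Lemma nord0_rec_ofS k a (s : seq h) :
  nord0_rec_of k.+1 (a :: s) = (md a 0 \o nord0_rec_of k s)
    + \sum_(i < size s) ((-1) ^+ i.+3 / 2 * form a (nth 0 s i))
                         *: nord0_rec_of k (take i s ++ drop i.+1 s).
Proof. by []. Qed.

Lemma nord0_rec_of_fuel k k' (s : seq h) : (size s <= k)%N -> (size s <= k')%N ->
  nord0_rec_of k s = nord0_rec_of k' s.
Proof.
elim: k k' s => [|k IH] [|k'] [|a s]; try by [].
rewrite /size -/size !ltnS => sk sk'; rewrite !nord0_rec_ofS (IH k' s sk sk').
congr (_ + _); apply: eq_bigr => i _.
have rest : (size (take i s ++ drop i.+1 s) <= size s)%N.
  by rewrite size_cat size_take size_drop ltn_ord; have := ltn_ord i; lia.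
by rewrite (IH k' _ (leq_trans rest sk) (leq_trans rest sk')).
Qed.

(** Counted from 0 in the word after a_1, the factor a_i has place j = i - 2, so (-1)^(i+1) =
    -(-1)^j: the recursive correction is minus an antiderivation with values (a_1, b)/2. *)
Lemma nord0_of_cons a (s : seq h) :
  nord0_of (a :: s) = md a 0 \o nord0_of s - deriv_word (fun b => form a b / 2) (nord0_of) s.
Proof.
rewrite /nord0_of [size _]/= nord0_rec_ofS (deriv_wordE _ _ _ 0) -sumrN; congr (_ + _).
apply: eq_bigr => i _; rewrite -scaleNr !exprS !mulN1r opprK; rewrite mulrA mulrAC !mulNr.
congr (_ *: _); apply: nord0_rec_of_fuel => //.
by rewrite size_cat size_take size_drop ltn_ord; have := ltn_ord i; lia.
Qed.

Definition mode_contraction (x y : h * int) : K :=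
  form x.1 y.1 * mode_pairing K x.2 y.2.

Hypothesis mode_lin : forall a m, linear (md a m).
Hypothesis mode_pos_neg : forall a b (m n : int), 0 < m -> n < 0 ->
  md a m \o md b n =
  (form a b * (m + n == 0)%:R) *: idfun - (md b n \o md a m).
Hypothesis mode_zero : forall a b (m : int), m != 0 ->
  md b 0 \o md a m = - (md a m \o md b 0).

Lemma prod_modes_of_lin (l : seq (h * int)) : linear (prod_modes_of l).
Proof.
elim: l => [|x l IH] c u v //=.
by rewrite IH mode_lin.
Qed.

Lemma prod_modes_of_zero b (l : seq (h * int)) w : all [pred x | x.2 != 0] l ->
  md b 0 (prod_modes_of l w) = (-1) ^+ size l *: prod_modes_of l (md b 0 w).
Proof.
elim: l => [|x l IH] /=; first by rewrite scale1r.
move=> /andP[/(mode_zero x.1 b)/(congr1 (@^~ (prod_modes_of l w))) /= -> /IH e].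
by rewrite -[X in X = _]/(- md x.1 x.2 (md b 0 (prod_modes_of l w))) e
           (linear_mapZ (mode_lin _ _)) exprS mulN1r scaleNr.
Qed.

(** Each negative mode that the positive mode passes costs a sign and leaves the scalar of their
    anticommutator. *)
Lemma prod_modes_of_pos a m (l : seq (h * int)) : 0 < m -> all [pred x | x.2 < 0] l ->
  md a m \o prod_modes_of l = (-1) ^+ size l *: (prod_modes_of l \o md a m)
   + deriv_word (mode_contraction (a, m)) prod_modes_of l.
Proof.
move=> m0; elim: l => [|x l IH] /=; first by rewrite scale1r deriv_word_nil addr0.
move=> /andP[x0 /IH e]; rewrite deriv_word_cons.
rewrite -[md a m \o _]/((md a m \o md x.1 x.2) \o prod_modes_of l) mode_pos_neg //.
rewrite (deriv_word_map (comp_linearl (mode_lin x.1 x.2))).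
rewrite -[LHS]/(_ *: prod_modes_of l - (md x.1 x.2 \o (md a m \o prod_modes_of l))) e.
rewrite (linear_mapD (comp_linearl (mode_lin x.1 x.2))).
rewrite (linear_mapZ (comp_linearl (mode_lin x.1 x.2))).
rewrite /mode_contraction /mode_pairing /= m0 mulr1 exprS mulN1r scaleNr opprD [RHS]addrCA.
by congr (_ + _).
Qed.

(** A negative [x] is already in place and contracts with nothing. A positive [x] has to pass the
    negative modes. A zero [x] passes all nonzero modes, with the same sign as in
    [deriv_sorted_zero], and then meets the recursion for zero modes. *)
Lemma nord_of_cons x s : nord_of (x :: s) =
  md x.1 x.2 \o nord_of s - deriv_word (mode_contraction x) (nord_of) s.
Proof.
have m_lin := comp_linearl (mode_lin x.1 x.2).
case: (ltgtP x.2 0) => x0.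
- rewrite /nord_of sorted_word_neg // (@deriv_word_vanish _ _ _ _ _ predT) ?all_predT ?subr0 //.
    by rewrite [in RHS]/sorted_word (linear_mapZ m_lin).
  by move=> y _; rewrite /mode_contraction /mode_pairing ltNge (ltW x0) /= (lt_eqF x0) !mulr0.
- rewrite /nord_of sorted_word_pos // deriv_sorted_neg => [|y y0]; last first.
    by rewrite /mode_contraction /mode_pairing gt_eqF ?ltr_wpDr //= mulr0n mul0r mulr0.
  rewrite [in RHS]/sorted_word (linear_mapZ m_lin) -scalerBr; congr (_ *: _).
  set R := prod_modes_of (pos_part s) \o nord0_of [seq x.1 | x <- zero_part s].
  rewrite -[md x.1 x.2 \o _]/((md x.1 x.2 \o prod_modes_of (neg_part s)) \o R).
  rewrite prod_modes_of_pos ?filter_all // -surjective_pairing.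
  have -> : deriv_word (mode_contraction x)
      (fun n => sorted_modes n (pos_part s) (zero_part s)) (neg_part s) =
    deriv_word (mode_contraction x) prod_modes_of (neg_part s) \o R.
    by rewrite -(deriv_word_map (comp_linearr R)).
  by rewrite -[RHS]/(_ + _ - _) addrK.
- rewrite /nord_of sorted_word_zero // deriv_sorted_zero => [|y y0]; last first.
    by rewrite /mode_contraction /mode_pairing x0 add0r (negbTE y0) /= mulr0n mul0r mulr0.
  rewrite [in RHS]/sorted_word (linear_mapZ m_lin) exprD -scalerA -scalerBr; congr (_ *: _).
  set R := prod_modes_of (neg_part s) \o prod_modes_of (pos_part s).
  have R_lin : linear R by move=> c u v; rewrite /R /= !prod_modes_of_lin.
  set z := zero_part s; have z0 : all [pred y : h * int | y.2 == 0] z by exact: filter_all.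
  rewrite -[sorted_modes _ _ (x :: _)]/(R \o nord0_of (x.1 :: [seq x.1 | x <- z])).
  rewrite nord0_of_cons (linear_mapB (comp_linearl R_lin)) scalerBr; congr (_ - _).
    apply/funext => w; rewrite -[LHS]/(_ *: R (md x.1 0 (nord0_of [seq x.1 | x <- z] w))).
    rewrite -[RHS]/(md x.1 x.2 (R _)) x0 /R /= !prod_modes_of_zero.
    - by rewrite (linear_mapZ (prod_modes_of_lin _)) scalerA exprD.
    - by apply: sub_all (filter_all _ s) => y /=; case: ltgtP.
    - by apply: sub_all (filter_all _ s) => y /=; case: ltgtP.
  congr (_ *: _).
  rewrite -[sorted_modes _ _]/((fun f => R \o f) \o (nord0_of \o map fst)).
  rewrite (deriv_word_map (comp_linearl R_lin)); congr (R \o _).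
  rewrite (deriv_word_mapl (psi := fun b => form x.1 b / 2) _ _ z0) // => y /eqP y0.
  by rewrite /mode_contraction /mode_pairing x0 y0 addr0 eqxx ltxx mul1r.
Qed.

End NordRecursion.

(** * The series G *)

Lemma fsum_single (I : choiceType) (V : nmodType) (i : I) (F : I -> V) :
  (forall j, j != i -> F j = 0) -> \sum_(j \in [set: I]) F j = F i.
Proof.
move=> F0; rewrite -(@fsbig_widen _ _ _ _ [set i]%classic) ?fsbig_set1 // => j /= [_ /eqP].
exact: F0.
Qed.

Section Series.
Variable K : numFieldType.

Lemma binzS (k : int) i : i.+1%:R * binz K k i.+1 = (k%:~R - i%:R) * binz K k i.
Proof.
rewrite /binz big_ord_recr /= factS natrM invfM.
have fi : i`!%:R != 0 :> K by rewrite pnatr_eq0 -lt0n fact_gt0.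
have si : i.+1%:R != 0 :> K by rewrite pnatr_eq0.
rewrite intrB; move: (\prod_(j < i) _) (i`!%:R) (i.+1%:R) fi si => a u v u0 v0.
by field; rewrite u0 v0.
Qed.

Lemma binz_pred (k : int) i : k%:~R * binz K (k - 1) i = i.+1%:R * binz K k i.+1.
Proof.
rewrite /binz big_ord_recl /= factS natrM invfM subr0.
have fi : i`!%:R != 0 :> K by rewrite pnatr_eq0 -lt0n fact_gt0.
have si : i.+1%:R != 0 :> K by rewrite pnatr_eq0.
have -> : \prod_(j < i) (k - 1 - j%:Z)%:~R = \prod_(j < i) (k - (lift ord0 j)%:Z)%:~R :> K.
  by apply: eq_bigr => j _; rewrite lift0 -addn1 PoszD opprD addrA addrAC.
move: (\prod_(j < i) _) (i`!%:R) (i.+1%:R) fi si => a u v u0 v0.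
by field; rewrite u0 v0.
Qed.

(** The expansion of 1/(x - y) is a geometric series: all its coefficients are 1. *)
Lemma binz_N1 i : binz K (- 1) i * (-1) ^+ i = 1.
Proof.
elim: i => [|i IH]; first by rewrite /binz big_ord0 mulr1 divr1.
have si : i.+1%:R != 0 :> K by rewrite pnatr_eq0.
apply: (mulfI si); rewrite mulrA binzS exprS mulr1.
transitivity (i.+1%:R * (binz K (- 1) i * (-1) ^+ i)); last by rewrite IH mulr1.
by rewrite -[in RHS]natr1 mulrNz; ring.
Qed.

Lemma iota_term_out c p q k (P Q : rat) : (forall i : nat, Q != q + i%:R) ->
  iota_term (K := K) (c, p, q, k) P Q = 0.
Proof.
move=> Qq; apply: fsbig1 => i _.
by rewrite [X in _ * X]/monom (negbTE (Qq i)) mulr0.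
Qed.

Lemma iota_termE c p q k (P Q : rat) i : Q = q + i%:R ->
  iota_term (K := K) (c, p, q, k) P Q =
  c * binz K k i * (-1) ^+ i * (P == p + k%:~R - i%:R)%:R.
Proof.
move=> ->; rewrite /iota_term (fsum_single (i := i)) => [|j ji].
  by rewrite [X in _ * X]/monom eqxx mulr1.
by rewrite [X in _ * X]/monom (inj_eq (addrI _)) eqr_nat eq_sym (negbTE ji) mulr0.
Qed.

Lemma nat_shiftP (Q q : rat) : {i : nat | Q = q + i%:R} + (forall i : nat, Q != q + i%:R).
Proof.
have [e|ne] := pselect (exists i : nat, Q = q + i%:R).
  by left; exact: cid.
by right=> i; apply/eqP => Qi; apply: ne; exists i.
Qed.

Lemma iota_gterm_dx t (P Q : rat) :
  iota_xy (gterm_dx t) P Q = ratr (P + 1) * iota_term (K := K) t (P + 1) Q.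
Proof.
case: t => [[[c p] q] k]; rewrite /iota_xy /gterm_dx /gterm_dy big_cons big_seq1.
have [[i Qi]|Qn] := nat_shiftP Q q; last by rewrite !iota_term_out ?addr0 ?mulr0.
rewrite !(iota_termE _ _ _ _ Qi).
have -> : (P == p + (k - 1)%:~R - i%:R) = (P == p - 1 + k%:~R - i%:R).
  by congr (_ == _); rewrite intrB; ring.
have -> : (P + 1 == p + k%:~R - i%:R) = (P == p - 1 + k%:~R - i%:R).
  by apply/eqP/eqP => e; lra.
case: eqP => [->|_]; last by rewrite !mulr0 addr0.
have -> : ratr (p - 1 + k%:~R - i%:R + 1) = ratr p + k%:~R - i%:R :> K.
  have -> : p - 1 + k%:~R - i%:R + 1 = p + k%:~R - i%:R by ring.
  by rewrite rmorphB rmorphD /= ratr_int ratr_nat.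
rewrite !mulr1.
(* The two summands combine through k C(k-1, i) = (k - i) C(k, i). *)
have e := binz_pred k i; rewrite binzS in e.
transitivity (c * (-1) ^+ i * (ratr p * binz K k i + k%:~R * binz K (k - 1) i)); first by ring.
by rewrite e; ring.
Qed.

Lemma iota_gterm_dy t (P Q : rat) :
  iota_xy (gterm_dy t) P Q = ratr (Q + 1) * iota_term (K := K) t P (Q + 1).
Proof.
case: t => [[[c p] q] k]; rewrite /iota_xy /gterm_dx /gterm_dy big_cons big_seq1.
have [[[|i] Qi]|Qn] := nat_shiftP (Q + 1) q.
(* At the lowest power of y only the derivative of y^q contributes; the term in (x - y)^(k-1) starts
   one power higher. *)
- rewrite (iota_termE _ _ _ _ Qi) (@iota_termE _ _ _ _ _ _ 0); last first.
    by move: Qi; rewrite !addr0 => <-; rewrite addrK.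
  rewrite iota_term_out => [|j]; last first.
    apply/eqP => Qj; have := ler0n rat j; move: Qi; rewrite addr0 Qj => e j0.
    by lra.
  by rewrite Qi !addr0; ring.
- have Qi1 : Q = q - 1 + i.+1%:R by apply: (addIr 1); rewrite Qi; ring.
  have Qi2 : Q = q + i%:R by apply: (addIr 1); rewrite Qi -natr1; ring.
  rewrite (iota_termE _ _ _ _ Qi) (iota_termE _ _ _ _ Qi1) (iota_termE _ _ _ _ Qi2).
  have -> : (P == p + (k - 1)%:~R - i%:R) = (P == p + k%:~R - i.+1%:R).
    by congr (_ == _); rewrite intrB -natr1; ring.
  case: eqP => [_|_]; last by rewrite !mulr0 addr0.
  rewrite Qi rmorphD /= ratr_nat !mulr1 exprS.
  transitivity (- c * (-1) ^+ i * (ratr q * binz K k i.+1 + k%:~R * binz K (k - 1) i)); first by ring.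
  by rewrite binz_pred; ring.
- rewrite [X in _ = _ * X]iota_term_out // mulr0 !iota_term_out ?addr0 // => i.
    by rewrite -(inj_eq (addIr 1)) -addrA natr1 Qn.
  by rewrite -(inj_eq (addIr 1)) addrAC subrK Qn.
Qed.

Lemma iota_gdx g (P Q : rat) : iota_xy (gdx g) P Q = ratr (P + 1) * iota_xy (K := K) g (P + 1) Q.
Proof.
rewrite /iota_xy /gdx big_flatten big_map mulr_sumr; apply: eq_bigr => t _.
exact: iota_gterm_dx.
Qed.

Lemma iota_gdy g (P Q : rat) : iota_xy (gdy g) P Q = ratr (Q + 1) * iota_xy (K := K) g P (Q + 1).
Proof.
rewrite /iota_xy /gdy big_flatten big_map mulr_sumr; apply: eq_bigr => t _.
exact: iota_gterm_dy.
Qed.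

Lemma iota_gscale (c : K) g (P Q : rat) : iota_xy (gscale c g) P Q = c * iota_xy g P Q.
Proof.
rewrite /iota_xy big_map mulr_sumr; apply: eq_bigr => -[[[d p] q] k] _.
have [[i Qi]|Qn] := nat_shiftP Q q; last by rewrite !iota_term_out ?mulr0 //.
by rewrite !(iota_termE _ _ _ _ Qi) !mulrA.
Qed.

Definition deriv_factor (m : nat) (q : rat) : K := \prod_(j < m) ratr (q + j.+1%:R).

Lemma deriv_factorS m q : deriv_factor m.+1 q = ratr (q + 1) * deriv_factor m (q + 1).
Proof.
rewrite /deriv_factor big_ord_recl; congr (_ * _); apply: eq_bigr => j _.
by rewrite lift0 -nat1r addrA.
Qed.

Lemma iter_sderiv m f q : iter m (@sderiv K) f q = deriv_factor m q * f (q + m%:R).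
Proof.
elim: m q => [|m IH] q; first by rewrite /deriv_factor big_ord0 mul1r addr0.
by rewrite iterS /sderiv IH deriv_factorS mulrA -addrA nat1r.
Qed.

(** Differentiation multiplies the coefficients of g by the same factors as those of the fields,
    which reduces the comparison with contractions to g itself. *)
Lemma GE m n (P Q : rat) : G m n P Q =
  (deriv_factor m P / m`!%:R) * (deriv_factor n Q / n`!%:R) *
  iota_xy (gxy K) (P + m%:R) (Q + n%:R).
Proof.
rewrite /G /gmn iota_gscale.
have -> (P' Q' : rat) : iota_xy (iter m (@gdx K) (iter n (@gdy K) (gxy K))) P' Q' =
    deriv_factor m P' * iota_xy (iter n (@gdy K) (gxy K)) (P' + m%:R) Q'.
  rewrite -(iter_sderiv m (fun P => iota_xy (iter n (@gdy K) (gxy K)) P Q')).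
  by elim: m P' => // m IH P'; rewrite !iterS iota_gdx IH.
have -> (P' Q' : rat) : iota_xy (iter n (@gdy K) (gxy K)) P' Q' =
    deriv_factor n Q' * iota_xy (gxy K) P' (Q' + n%:R).
  rewrite -(iter_sderiv n (fun Q => iota_xy (gxy K) P' Q)).
  by elim: n Q' => // n IH Q'; rewrite !iterS iota_gdy IH.
by rewrite invfM; ring.
Qed.

(** The solution n of -n - 1/2 = q + m. When it is not an integer, its floor below is a dummy value
    and the coefficient is 0. *)
Definition half_exp (m : nat) (q : rat) : rat := - (q + m%:R + 1 / 2).

(* The coefficient of x^q in a^(m)(x) is [field_coeff m q] times the mode of index
   [field_mode m q]. *)
Definition field_mode (m : nat) (q : rat) : int := Num.floor (half_exp m q).
Definition field_coeff (m : nat) (q : rat) : K :=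
  if half_exp m q \is a Num.int then deriv_factor m q / m`!%:R else 0.

Lemma sderivd_monom m (n : int) q :
  sderivd m (monom K (- n%:~R - 1 / 2)) q = field_coeff m q * (n == field_mode m q)%:R.
Proof.
rewrite /sderivd iter_sderiv /monom /field_coeff /field_mode.
have -> : (q + m%:R == - n%:~R - 1 / 2) = (half_exp m q == n%:~R).
  by rewrite /half_exp; apply/eqP/eqP => e; lra.
case: ifPn => [/floorK e|ni].
  by rewrite -[in LHS]e eqr_int eq_sym mulrA [_^-1 * _]mulrC.
rewrite mul0r; case: eqP => [e|_]; last by rewrite !mulr0.
by move: ni; rewrite e intr_int.
Qed.

(** The expansion of g is x^(-1/2) y^(-1/2) times 1/2 + (y/x) + (y/x)^2 + ... . For n < 0 the two
    terms of [gxy] give 1/2 each, for n = 0 only the first contributes, and for n > 0 neither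
    does. *)
Lemma iota_gxy_int (m n : int) :
  iota_xy (gxy K) (- m%:~R - 1 / 2) (- n%:~R - 1 / 2) = mode_pairing K m n.
Proof.
have half : 2 * 2^-1 = 1 :> K by rewrite mulfV // pnatr_eq0.
rewrite /iota_xy /gxy big_cons big_seq1 /mode_pairing; case: n => [[|k]|k].
- rewrite mulr0z oppr0 sub0r (@iota_termE _ _ _ _ _ _ 0) ?addr0 //.
  rewrite iota_term_out => [|j]; last first.
    by apply/negbT/lt_eqF; have := ler0n rat j; clear; lra.
  rewrite -[2^-1 * _ * _]mulrA binz_N1 mulr1 addr0 mulrC.
  have -> : (- m%:~R - 1 / 2 == 1 / 2 + (- 1)%:~R - 0 :> rat) = (m == 0).
    by rewrite -(eqr_int rat); apply/eqP/eqP => e; lra.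
  by case: eqP => [->|_]; rewrite ?ltxx ?mul0r.
- have k0 := ler0n rat k; rewrite -[Posz k.+1]/(k.+1%:Z) -pmulrn -natr1.
  rewrite !iota_term_out => [|j|j]; last 2 first.
  - by apply/negbT/lt_eqF; have := ler0n rat j; move: k0; clear; lra.
  - by apply/negbT/lt_eqF; have := ler0n rat j; move: k0; clear; lra.
  rewrite addr0; case: eqP => [e|_]; last by rewrite mul0r.
  have -> : (0 < m) = false by lia.
  have -> : (m == 0) = false by lia.
  by rewrite mulr0.
- have kE : (Negz k)%:~R = - (k%:R + 1) :> rat by rewrite NegzE mulrNz -pmulrn natr1.
  rewrite (@iota_termE _ _ _ _ _ _ k.+1) ?(@iota_termE _ _ _ _ _ _ k); last 2 first.
  - by rewrite kE -?(natr1 k); lra.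
  - by rewrite kE -?(natr1 k); lra.
  rewrite -![2^-1 * binz _ _ _ * _]mulrA !binz_N1 !mulr1.
  have -> : (- m%:~R - 1 / 2 == 1 / 2 + (- 1)%:~R - k.+1%:R :> rat) = (m + Negz k == 0).
    by rewrite -(eqr_int rat) intrD kE -(natr1 k); apply/eqP/eqP => e; lra.
  have -> : (- m%:~R - 1 / 2 == - (1 / 2) + (- 1)%:~R - k%:R :> rat) = (m + Negz k == 0).
    by rewrite -(eqr_int rat) intrD kE; apply/eqP/eqP => e; lra.
  rewrite -mulrDl -[2^-1]mul1r -mulrDl half mul1r.
  case: eqP => [e|_]; last by rewrite mul0r.
  have -> : 0 < m by lia.
  by rewrite mulr1.
Qed.

Lemma iota_gxy_out (P Q : rat) :
  (- (P + 1 / 2) \isn't a Num.int) || (- (Q + 1 / 2) \isn't a Num.int) ->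
  iota_xy (gxy K) P Q = 0.
Proof.
move=> nPQ; rewrite /iota_xy /gxy big_cons big_seq1.
have PQ (i j : int) : P = - i%:~R - 1 / 2 -> Q = - j%:~R - 1 / 2 -> False.
  move=> Pi Qj; move: nPQ; rewrite Pi Qj.
  by rewrite !subrK !opprK !intr_int.
have t1 : iota_term (2^-1 : K, 1 / 2, - (1 / 2), - 1) P Q = 0.
  have [[i Qi]|Qn] := nat_shiftP Q (- (1 / 2)); last exact: iota_term_out.
  rewrite (iota_termE _ _ _ _ Qi); case: eqP => [Pi|_]; last by rewrite mulr0.
  by case: (PQ i%:Z (- i%:Z)); rewrite ?mulrNz -!pmulrn; lra.
have t2 : iota_term (2^-1 : K, - (1 / 2), 1 / 2, - 1) P Q = 0.
  have [[i Qi]|Qn] := nat_shiftP Q (1 / 2); last exact: iota_term_out.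
  rewrite (iota_termE _ _ _ _ Qi); case: eqP => [Pi|_]; last by rewrite mulr0.
  by case: (PQ i.+1%:Z (- i.+1%:Z)); rewrite ?mulrNz -!pmulrn -(natr1 i); lra.
by rewrite t1 t2 addr0.
Qed.

Lemma field_contraction m n (P Q : rat) :
  G m n P Q = field_coeff m P * field_coeff n Q * mode_pairing K (field_mode m P) (field_mode n Q).
Proof.
rewrite GE /field_coeff -iota_gxy_int /field_mode.
case: ifPn => [/floorK Pi|Pn]; last first.
  by rewrite (@iota_gxy_out (P + _)) ?Pn // mulr0 !mul0r.
case: ifPn => [/floorK Qi|Qn]; last first.
  by rewrite (@iota_gxy_out (P + _)) ?Qn ?orbT // !mulr0 !mul0r.
by rewrite Pi Qi /half_exp !opprK !addrK.
Qed.

End Series.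

(** * The modes on W *)

Section LinearExtension.
Variables (K : comNzRingType) (A : choiceType).
Implicit Types g : {malg K[A]}.

Lemma malg_ind (P : {malg K[A]} -> Prop) :
  P 0 -> (forall c x g, P g -> P (c *: << x >> + g)) -> forall g, P g.
Proof.
move=> P0 PD g; rewrite [g]monalgE.
elim: (enum_fset _) => [|x l IH]; first by rewrite big_nil.
rewrite big_cons; suff -> : << mcoeff x g *g x >> = mcoeff x g *: << x >> by exact: PD.
by apply/malgP => y; rewrite mcoeffZ !mcoeffU mulrnAr mulr1.
Qed.

Variables (V : lmodType K) (c : A -> V).

Definition malg_ext g : V := \sum_(x <- enum_fset (msupp g)) mcoeff x g *: c x.

Lemma malg_extEw g (d : {fset A}) : (msupp g `<=` d)%fset ->
  malg_ext g = \sum_(x <- enum_fset d) mcoeff x g *: c x.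
Proof.
move=> gd; rewrite /malg_ext; apply: big_fset_incl => // x _ /mcoeff_outdom ->.
by rewrite scale0r.
Qed.

Lemma malg_extU x : malg_ext << x >> = c x.
Proof. by rewrite (malg_extEw msuppU_le) big_seq_fset1 mcoeffUU scale1r. Qed.

Lemma malg_ext_linear : linear malg_ext.
Proof.
move=> k g g'; pose d := (msupp (k *: g + g') `|` (msupp g `|` msupp g'))%fset.
rewrite !(@malg_extEw _ d); last 3 first.
- by rewrite fsubsetU // fsubsetUr orbT.
- by rewrite fsubsetU // fsubsetUl orbT.
- by rewrite fsubsetUl.
rewrite scaler_sumr -big_split; apply: eq_bigr => x _ /=.
by rewrite mcoeffD mcoeffZ scalerDl scalerA.
Qed.

End LinearExtension.

Section Span0.
Variables (K : comNzRingType) (V V' : lmodType K) (S : V -> Prop) (L : V -> V').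
Hypothesis L_lin : linear L.

Lemma span_eq0 : (forall v, S v -> L v = 0) -> forall v, v \in Defs.span S -> L v = 0.
Proof.
move=> S0 v /Defs.spanP[l lS ->]; elim: l lS => [|x l IH] lS.
  by rewrite big_nil (linear_map0 L_lin).
rewrite big_cons L_lin S0 ?scaler0 ?add0r; last by apply: lS; rewrite mem_head.
by apply: IH => y yl; apply: lS; rewrite inE yl orbT.
Qed.

End Span0.

Lemma lquot0 (K : comNzRingType) (V : lmodType K) (S : V -> Prop) :
  \pi_(lquot S) 0 = 0.
Proof.
by have e := lquotZ S 0 0; rewrite scale0r in e; exact: etrans e (scale0r _).
Qed.

Section TensMap.
Variables (K : comNzRingType) (P Q : lmodType K) (I : Type).
Variables (actP : I -> P -> P) (actQ : I -> Q -> Q).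
Local Notation T := (tens actP actQ).
Local Notation tsr := (tensor actP actQ).

Lemma tensor_linearr p : linear (tsr p).
Proof. by move=> c q q'; rewrite tensorDr tensorZr. Qed.

Lemma tens_ind (R : T -> Prop) :
  R 0 -> (forall k u v, R u -> R v -> R (k *: u + v)) -> (forall p q, R (tsr p q)) ->
  forall w, R w.
Proof.
move=> R0 RD Rt; elim/quotW; elim/malg_ind => [|k [p q] g Rg].
  by rewrite lquot0.
by rewrite lquotD lquotZ; exact: (RD _ _ _ (Rt p q) Rg).
Qed.

Variable f : {linear P -> P}.
Hypothesis f_act : forall i, {morph f : p / actP i p}.

(** [tens_map] is computed on a chosen representative, which is not additive; since the linear
    extension of (p, q) |-> f p (x) q kills the relations, any representative gives the same
    value. *)
Lemma tens_map_linear : linear (tens_map f : T -> T).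
Proof.
pose c (x : P * Q) := tsr (f x.1) x.2.
have c_rel g : tens_rel actP actQ g -> malg_ext c g = 0.
  have cD := linear_mapD (malg_ext_linear c); have cZ := linear_mapZ (malg_ext_linear c).
  by case=> [p p' q|p q q'|k p q|k p q|i p q];
    rewrite (linear_mapB (malg_ext_linear c)) ?cD ?cZ !malg_extU /c /=
      ?linearD ?linearZ ?f_act /= ?tensorDl ?tensorDr ?tensorZl ?tensorZr ?tensor_act
      -?opprD ?scalerN subrr.
have E g : tens_map f (\pi_(lquot (tens_rel actP actQ)) g : T) = malg_ext c g.
  have /lquot_eqP/(span_eq0 (malg_ext_linear c) c_rel) :
    \pi_(lquot (tens_rel actP actQ)) (repr (\pi_(lquot (tens_rel actP actQ)) g)) =
    \pi_(lquot (tens_rel actP actQ)) g by rewrite reprK.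
  rewrite -scaleN1r addrC malg_ext_linear scaleN1r addrC => /eqP.
  by rewrite subr_eq0 => /eqP <-.
move=> k; elim/quotW => g; elim/quotW => g'.
rewrite -[_ *: _]lquotZ -lquotD !E.
exact: malg_ext_linear.
Qed.

End TensMap.

Section AlgebraGeneration.
Variables (K : comNzRingType).

Lemma aquot_relB (A : algType K) (S : A -> Prop) x y :
  S (x - y) -> \pi_(aquot S) x = \pi_(aquot S) y.
Proof.
move=> Sxy; apply/lquot_eqP; apply: span_mem.
by exists 1, (x - y), 1; rewrite mul1r mulr1.
Qed.

Lemma aquot_rel (A : algType K) (S : A -> Prop) x : S x -> \pi_(aquot S) x = 0.
Proof.
by move=> Sx; rewrite (@aquot_relB _ _ _ 0) ?subr0 // lquot0.
Qed.

Lemma freealg_ind (X : choiceType) (P : freealg K X -> Prop) :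
  P 0 -> P 1 -> (forall c x y, P x -> P y -> P (c *: x + y)) ->
  (forall v x, P x -> P (freegen v * x)) -> forall x, P x.
Proof.
move=> P0 P1 PD PM; apply: malg_ind => // c [k] g Pg; apply: PD => // {g Pg}.
elim: k => [|v k IH].
  by move: P1; congr P; congr << _ >>; apply/eqP; rewrite fmP fm1.
suff -> : << FMonom (v :: k) >> = freegen v * << FMonom k >> :> freealg K X by exact: PM.
transitivity (<< (1 * 1 : K) *g mmul (fmu v) (FMonom k) >> : {malg K[{fmonom X}]}).
  by rewrite mulr1; congr << _ >>; apply/eqP; rewrite fmP fmM fmU.
by rewrite -fgmulUU.
Qed.

End AlgebraGeneration.

Section TensorAlgebraGeneration.
Variables (K : comNzRingType) (V : lmodType K).

Lemma tensgen_linear : linear (@tensgen K V).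
Proof.
have eD u v : tensgen (u + v) = tensgen u + tensgen v.
  exact: etrans (aquot_relB (TensalgD u v)) (lquotD _ _ _).
have eZ c v : tensgen (c *: v) = c *: tensgen v.
  exact: etrans (aquot_relB (TensalgZ c v)) (lquotZ _ _ _).
by move=> c u v; rewrite eD eZ.
Qed.

Lemma tensalg_ind (P : tensalg V -> Prop) :
  P 0 -> P 1 -> (forall c x y, P x -> P y -> P (c *: x + y)) ->
  (forall v x, P x -> P (tensgen v * x)) -> forall x, P x.
Proof.
move=> P0 P1 PD PM; elim/quotW; apply: freealg_ind.
- by rewrite lquot0.
- by [].
- by move=> c x y Px Py; rewrite lquotD lquotZ; exact: PD.
- by move=> v x Px; rewrite aquotM; exact: PM.
Qed.

End TensorAlgebraGeneration.

Section LoopGeneration.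
Variables (K : numFieldType) (h : lmodType K).

Lemma loop_ind (R : loop h -> Prop) :
  R 0 -> (forall c u v, R u -> R v -> R (c *: u + v)) ->
  (forall a n, R (tensor _ _ a (<< n >> : laurent K))) -> forall l, R l.
Proof.
move=> R0 RD Rm; apply: tens_ind => // a.
pose t (g : laurent K) : loop h := tensor (fun _ : void => @idfun h) (fun=> idfun) a g.
have t_lin : linear t by exact: tensor_linearr.
suff Rt : forall g : {malg K[int]}, R (t g) by exact: Rt.
apply: malg_ind => [|c n g Rg].
  have -> : t (0 : laurent K) = 0 by exact: linear_map0 t_lin.
  exact: R0.
have -> : t (c *: (<< n >> : laurent K) + g) = c *: t << n >> + t g by exact: t_lin.
apply: (RD _ _ _ _ Rg); exact: Rm.
Qed.

End LoopGeneration.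

Lemma mulr_assoc_pair (R : pzRingType) (a b x : R) :
  a * (b * x) + b * (a * x) = (a * b + b * a) * x.
Proof. by rewrite !mulrA mulrDl. Qed.

(** Used with t = (- (x) u), to read anticommutators of modes on W as products in N. *)
Lemma intertwine_sum (K : comNzRingType) (N W : lmodType K) (A B : W -> W) (t : N -> W)
    (fa fb : N -> N) : linear t -> (forall y, A (t y) = t (fa y)) ->
  (forall y, B (t y) = t (fb y)) ->
  forall x, A (B (t x)) + B (A (t x)) = t (fa (fb x) + fb (fa x)).
Proof. by move=> t_lin eA eB x; rewrite eA !eB eA (linear_mapD t_lin). Qed.

Lemma anticomm_closed (K : comNzRingType) (W : lmodType K) (A B : W -> W) (k c : K) u v :
  linear A -> linear B -> A (B u) + B (A u) = k *: u -> A (B v) + B (A v) = k *: v ->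
  A (B (c *: u + v)) + B (A (c *: u + v)) = k *: (c *: u + v).
Proof.
move=> A_lin B_lin eu ev; rewrite !(A_lin, B_lin) addrACA -scalerDr eu ev.
by rewrite !scalerA mulrC -scalerA [RHS]scalerDr !scalerA.
Qed.

Lemma anticomm0 (K : comNzRingType) (W : lmodType K) (A B : W -> W) (k : K) :
  linear A -> linear B -> A (B 0) + B (A 0) = k *: 0.
Proof.
by move=> A_lin B_lin; rewrite !(linear_map0 A_lin, linear_map0 B_lin) addr0 scaler0.
Qed.

Lemma addr0_eq_opp (V : zmodType) (x y : V) : x + y = 0 -> x = - y.
Proof. by move/eqP; rewrite addr_eq0 => /eqP. Qed.

(** * Anticommutators of the modes *)

Section Modes.
Variables (K : numFieldType) (h : lmodType K) (form : h -> h -> K).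
Local Notation N := (nalg form).
Local Notation pi_n := (\pi_(aquot (nalg_rel form))).
Local Notation kc := (ncentral form).

Lemma nalg_piM (x y : tensalg (hhat h)) : pi_n (x * y) = pi_n x * pi_n y :> N.
Proof. exact: aquotM. Qed.

Lemma nalg_pi_linear : linear (fun x : tensalg (hhat h) => pi_n x : N).
Proof. by move=> c x y; rewrite aquotD aquotZ. Qed.

Lemma nmode_central a (n : int) : nmode form a n * kc = kc * nmode form a n.
Proof.
pose t := tensgen (hmode a n); pose k := tensgen (hcentral h).
have e : pi_n (t * k) = pi_n (k * t) := aquot_relB (NalgCentral form a n).
change (pi_n t * pi_n k = pi_n k * pi_n t).
rewrite -!nalg_piM.
exact: e.
Qed.

(** Modes multiply N on the left, whereas k becomes 1 only across the tensor sign, on the right of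
    N. Centrality carries it from one side to the other. *)
Lemma ncentral_comm (x : N) : kc * x = x * kc.
Proof.
have comm_lin c y z : kc * y = y * kc -> kc * z = z * kc ->
    kc * (c *: y + z) = (c *: y + z) * kc.
  by move=> ey ez; rewrite mulrDr mulrDl ez -aquot_scaleAr -aquot_scaleAl ey.
have pi_lin c (u v : tensalg (hhat h)) : pi_n (c *: u + v) = c *: pi_n u + pi_n v.
  exact: nalg_pi_linear.
pose gen v : N := pi_n (tensgen v).
have gen_lin c u v : gen (c *: u + v) = c *: gen u + gen v.
  by rewrite /gen tensgen_linear pi_lin.
have gen_comm v : kc * gen v = gen v * kc.
  case: v => l c; have -> : (l, c) = c *: hcentral h + (l, 0).
    rewrite -[RHS]/(c *: (0 : loop h) + l, c *: (1 : K^o) + 0) scaler0 add0r addr0.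
    by rewrite (mulr1 c : c *: (1 : K^o) = c).
  rewrite gen_lin; apply: (comm_lin _ _ _); first exact: (erefl (kc * kc)).
  clear c; have loop_lin c u v : gen (c *: u + v, 0) = c *: gen (u, 0) + gen (v, 0).
    rewrite -gen_lin; congr gen; rewrite -[RHS]/(c *: u + v, c *: (0 : K^o) + 0).
    by rewrite scaler0 addr0.
  have gen0 : gen (0, 0) = 0.
    by have := loop_lin (-1) 0 0; rewrite scaler0 addr0 scaleN1r addNr.
  elim/loop_ind: l => [|c u v eu ev|a n].
  - by rewrite gen0 mulr0 mul0r.
  - rewrite loop_lin; exact (comm_lin _ _ _ eu ev).
  - have e : gen (tensor (fun=> idfun) (fun=> idfun) a (<< n >> : laurent K), 0) = nmode form a n.
      exact: erefl.
    rewrite e; exact: esym (nmode_central a n).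
elim/quotW: x; apply: tensalg_ind.
- by rewrite lquot0 mulr0 mul0r.
- by rewrite mulr1 mul1r.
- by move=> c x y ex ey; rewrite pi_lin; exact (comm_lin _ _ _ ex ey).
- move=> v x ex; rewrite nalg_piM mulrA gen_comm -[LHS]mulrA ex.
  exact (mulrA _ _ _).
Qed.

Lemma nmode_pos_neg a b (m n : int) : 0 < m -> n < 0 ->
  nmode form a m * nmode form b n + nmode form b n * nmode form a m =
  (form a b * (m + n == 0)%:R) *: kc.
Proof.
move=> m0 n0; rewrite -[X in X + _ = _]aquotM -[X in _ + X = _]aquotM -aquotD -[RHS]aquotZ.
exact: aquot_relB (NalgPosNeg form a b m0 n0).
Qed.

(** The right side is kept as a multiple of k so that [mode_anticomm] covers both kinds of
    relations. *)
Lemma nmode_zero a b (m : int) : m != 0 ->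
  nmode form b 0 * nmode form a m + nmode form a m * nmode form b 0 = 0 *: kc.
Proof.
move=> m0; rewrite addrC scale0r.
rewrite -[X in X + _ = _]aquotM -[X in _ + X = _]aquotM -aquotD.
exact: aquot_rel (NalgZero form a b m0).
Qed.

Variable U : lmodType (tensalg h).
Local Notation W := (spaceW form U).

Lemma mode_linear a n : linear (mode a n : W -> W).
Proof.
pose f : N -> N := fun y => nmode form a n * y.
have fl : linear f.
  by move=> c y z; rewrite /f mulrDr; congr (_ + _); rewrite aquot_scaleAr.
pose lf := GRing.isLinear.Build K N N *:%R f fl.
pose F : {linear N -> N} := HB.pack f lf.
apply: (@tens_map_linear _ _ _ _ _ _ F) => -[b k|b|] y; rewrite /= /f mulrA //.
Qed.

Let tsr := tensor (bgen_nalg (form := form)) (@bgen_U _ _ U).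

Lemma tensor_linearl u : linear (tsr^~ u).
Proof.
move=> c x y.
exact (etrans (tensorDl _ _ _ _ _) (congr1 (+%R^~ _) (tensorZl _ _ _ _ _))).
Qed.

Lemma mode_sum_tensor a b (m n : int) x u :
  mode a m (mode b n (tsr x u)) + mode b n (mode a m (tsr x u)) =
  tsr ((nmode form a m * nmode form b n + nmode form b n * nmode form a m) * x) u.
Proof.
rewrite -mulr_assoc_pair.
exact (intertwine_sum (tensor_linearl u) (fun y => modeE a m y u) (fun y => modeE b n y u) x).
Qed.

Lemma tensor_central x u : tsr (kc * x) u = tsr x u.
Proof.
rewrite ncentral_comm; exact (tensor_act _ _ (BCentral h) x u).
Qed.

Lemma mode_anticomm a b (m n : int) k (w : W) :
  nmode form a m * nmode form b n + nmode form b n * nmode form a m = k *: kc ->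
  mode a m (mode b n w) + mode b n (mode a m w) = k *: w.
Proof.
move=> e; have A_lin := mode_linear a m; have B_lin := mode_linear b n.
elim/tens_ind: w => [|c u v eu ev|x u].
- exact (anticomm0 _ A_lin B_lin).
- exact (anticomm_closed _ A_lin B_lin eu ev).
rewrite mode_sum_tensor e -[X in tsr X u]aquot_scaleAl.
have z := linear_mapZ (tensor_linearl u) k (kc * x).
rewrite z tensor_central.
reflexivity.
Qed.

Lemma mode_pos_neg a b (m n : int) : 0 < m -> n < 0 ->
  mode a m \o mode b n =
  (form a b * (m + n == 0)%:R) *: idfun - (mode b n \o mode a m) :> (W -> W).
Proof.
move=> m0 n0; apply/funext => w.
have e := mode_anticomm w (nmode_pos_neg a b m0 n0).
exact (canRL (addrK _) e).
Qed.

Lemma mode_zero a b (m : int) : m != 0 ->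
  mode b 0 \o mode a m = - (mode a m \o mode b 0) :> (W -> W).
Proof.
move=> m0; apply/funext => w.
have := mode_anticomm w (nmode_zero a b m0); rewrite scale0r => e.
exact (addr0_eq_opp e).
Qed.

End Modes.

(** * Fields *)

Section FieldLetters.
Variables (K : numFieldType) (h : lmodType K) (form : h -> h -> K).
Local Notation letter := (h * nat * rat)%type.
Implicit Types (x y : letter) (s : seq letter).

Definition letter_coeff x : K := field_coeff K x.1.2 x.2.

Definition letter_mode x : h * int := (x.1.1, field_mode x.1.2 x.2).

Definition letter_contraction x y : K := form x.1.1 y.1.1 * G x.1.2 y.1.2 x.2 y.2.

Lemma letter_contractionE x y : letter_contraction x y =
  letter_coeff x * letter_coeff y * mode_contraction form (letter_mode x) (letter_mode y).
Proof.
by rewrite /letter_contraction field_contraction mulrCA !mulrA [_ * form _ _]mulrC !mulrA.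
Qed.

Lemma sum_field_modes (V : lmodType K) (F : seq (h * int) -> V) s :
  \sum_(n \in [set: (size s).-tuple int])
    (\prod_(i < size s)
       let: (a, m, q) := tnth (in_tuple s) i in
       sderivd m (monom K (- (tnth n i)%:~R - 1 / 2)) q) *:
    F [seq (z.1.1.1, z.2) | z <- zip s n] =
  (\prod_(x <- s) letter_coeff x) *: F [seq letter_mode x | x <- s].
Proof.
(* The only choice of mode indices compatible with the given exponents. *)
pose n0 : (size s).-tuple int := [tuple of [seq (letter_mode x).2 | x <- in_tuple s]].
have coefE (n : (size s).-tuple int) :
    \prod_(i < size s) (let: (a, m, q) := tnth (in_tuple s) i in
       sderivd m (monom K (- (tnth n i)%:~R - 1 / 2)) q) =
    \prod_(i < size s) (letter_coeff (tnth (in_tuple s) i) * (tnth n i == tnth n0 i)%:R).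
  apply: eq_bigr => i _; rewrite tnth_map; case: (tnth _ _) => [[a m] q].
  exact: sderivd_monom.
rewrite (fsum_single (i := n0)) => [|n nn0]; last first.
  rewrite coefE; have [i ni] : exists i, tnth n i != tnth n0 i.
    apply/existsP; rewrite -negb_forall; apply: contra nn0 => /forallP e.
    by apply/eqP/eq_from_tnth => i; apply/eqP.
  by rewrite (bigD1 i) //= (negbTE ni) mulr0 mul0r scale0r.
rewrite coefE big_tnth; congr (_ *: F _).
  by apply: eq_bigr => i _; rewrite eqxx mulr1.
rewrite /=; elim: (s) => //= x t ->; by case: x => [[]].
Qed.

(** The contraction of letters carries the coefficient of the removed letter, so the product over
    all of [s] factors out. *)
Lemma deriv_letters (V : lmodType K) (F : seq (h * int) -> V) x s :
  deriv_word (letter_contraction x)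
    (fun t => (\prod_(y <- t) letter_coeff y) *: F [seq letter_mode y | y <- t]) s =
  (letter_coeff x * \prod_(y <- s) letter_coeff y) *:
    deriv_word (mode_contraction form (letter_mode x)) F [seq letter_mode y | y <- s].
Proof.
elim: s F => [|y s IH] F; first by rewrite !deriv_word_nil scaler0.
rewrite /= !deriv_word_cons big_cons scalerBr scalerA letter_contractionE; congr (_ - _).
  by rewrite scalerA; congr (_ *: _); rewrite mulrAC -!mulrA; do 2 congr (_ * _); rewrite mulrC.
rewrite (eq_deriv_wordr _ (g := fun t => letter_coeff y *: ((\prod_(y <- t) letter_coeff y) *:
   (F \o cons (letter_mode y)) [seq letter_mode y | y <- t]))) => [|t].
  by rewrite deriv_wordZ IH scalerA mulrCA.
by rewrite /= big_cons scalerA.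
Qed.

Variables (W : lmodType K) (md : h -> int -> W -> W).

Definition fields_of s : W -> W :=
  (\prod_(x <- s) letter_coeff x) *: nord_of form md [seq letter_mode x | x <- s].

Definition letter_op x : W -> W := letter_coeff x *: md (letter_mode x).1 (letter_mode x).2.

Hypothesis mode_lin : forall a m, linear (md a m).
Hypothesis mode_pos_neg : forall a b (m n : int), 0 < m -> n < 0 ->
  md a m \o md b n = (form a b * (m + n == 0)%:R) *: idfun - (md b n \o md a m).
Hypothesis mode_zero : forall a b (m : int), m != 0 ->
  md b 0 \o md a m = - (md a m \o md b 0).

Lemma letter_op_lin x : linear (letter_op x).
Proof.
move=> c u v; rewrite -![letter_op x _]/(_ *: _) mode_lin scalerDr !scalerA.
by rewrite mulrC.
Qed.

Lemma fields_of_nil : fields_of [::] = idfun.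
Proof. by rewrite /fields_of big_nil scale1r /nord_of /sorted_word scale1r. Qed.

Lemma fields_of_cons x s : fields_of (x :: s) =
  (letter_op x \o fields_of s) - deriv_word (letter_contraction x) fields_of s.
Proof.
rewrite deriv_letters {1}/fields_of /= nord_of_cons // big_cons scalerBr; congr (_ - _).
rewrite /letter_op /fields_of -[RHS]/(letter_coeff x *: (_ \o _)).
by rewrite [in RHS](linear_mapZ (comp_linearl (mode_lin _ _)) (\prod_(y <- s) _)) scalerA.
Qed.

Lemma fields_of_wick r n (a : 'I_r -> letter) (b : 'I_n -> letter) :
  fields_of [seq a i | i <- enum 'I_r] \o fields_of [seq b j | j <- enum 'I_n] =
  fields_of ([seq a i | i <- enum 'I_r] ++ [seq b j | j <- enum 'I_n])
  + \sum_(1 <= rho < (minn r n).+1)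
      \sum_(i : {ffun 'I_rho -> 'I_r} | increasing i)
      \sum_(j : {ffun 'I_rho -> 'I_n} | increasing j)
        ((-1) ^+ (\sum_k (i k).+1 + \sum_k (j k).+1)
         * (-1) ^+ (r * rho + (rho * rho.+1) %/ 2)
         * \det (\matrix_(k < rho, l < rho) letter_contraction (a (i k)) (b (j l))))
        *: fields_of (omit a i ++ omit b j).
Proof. exact: wick letter_op_lin fields_of_nil fields_of_cons _ _ _ _. Qed.

End FieldLetters.

Section Fields.
Variables (K : numFieldType) (h : lmodType K) (form : h -> h -> K).
Variable U : lmodType (tensalg h).

Lemma nord_ofE s : nord form U s = nord_of form (@mode K h form U) s.
Proof.
rewrite /nord odd_nord_perm signr_odd.
reflexivity.
Qed.

Lemma nord_fieldsE s : nord_fields form U s = fields_of form (@mode K h form U) s.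
Proof.
rewrite /fields_of -nord_ofE.
exact (sum_field_modes (nord form U) s).
Qed.

End Fields.

Theorem theorem4p7 (R : realType) (M : nat)
    (form : {symmetric 'rV[R[i]]_(2 * M)}) (form_nondeg : nondegenerate form)
    (U : lmodType (tensalg 'rV[R[i]]_(2 * M)))
    (r s : nat) (r_gt0 : (0 < r)%N) (s_gt0 : (0 < s)%N)
    (a : 'I_r -> 'rV[R[i]]_(2 * M)) (b : 'I_s -> 'rV[R[i]]_(2 * M))
    (m : 'I_r -> nat) (n : 'I_s -> nat)
    (p : 'I_r -> rat) (q : 'I_s -> rat) :
  nord_fields form U [seq (a i, m i, p i) | i <- enum 'I_r] \o
    nord_fields form U [seq (b j, n j, q j) | j <- enum 'I_s]
  = nord_fields form U ([seq (a i, m i, p i) | i <- enum 'I_r] ++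
                        [seq (b j, n j, q j) | j <- enum 'I_s])
    + \sum_(1 <= rho < (minn r s).+1)
        \sum_(i : {ffun 'I_rho -> 'I_r} | increasing i)
        \sum_(j : {ffun 'I_rho -> 'I_s} | increasing j)
          ((-1) ^+ (\sum_k (i k).+1 + \sum_k (j k).+1)
           * (-1) ^+ (r * rho + (rho * rho.+1) %/ 2)
           * \det (\matrix_(k < rho, l < rho)
                     (form (a (i k)) (b (j l)) *
                      G (m (i k)) (n (j l)) (p (i k)) (q (j l)))))
          *: nord_fields form U
               ([seq (a k, m k, p k) | k <- enum 'I_r & k \notin codom i] ++
                [seq (b l, n l, q l) | l <- enum 'I_s & l \notin codom j]).
Proof.
rewrite !nord_fieldsE (fields_of_wick (@mode_linear _ _ form U) (@mode_pos_neg _ _ form U)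
  (@mode_zero _ _ form U)).
apply: (congr1 (+%R _)); apply: eq_bigr => rho _.
apply: eq_bigr => i _; apply: eq_bigr => j _; rewrite nord_fieldsE.
reflexivity.
Qed.
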